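(* Let $A$ be a non-Archimedean Polish abelian group. The following assertions are equivalent: (1) $A$ is projective in $\mathbf{PAb}_{\mathrm{nA}}$; (2) $A$ is isomorphic to $\mathbb{Z}^{\alpha }\oplus ( \mathbb{Z}^{( \omega ) }) ^{\beta }$ for some $\alpha ,\beta \leq \omega $; (3) $\mathrm{Ext}( A,\mathbb{Z}) =0$ and $\mathrm{Ext}( A,\mathbb{Z}^{( \omega ) }) =0$.
   Context: A Polish abelian group is an abelian topological group whose topology is Polish. It is non-Archimedean if it has a basis of zero neighborhoods consisting of subgroups (all such groups are pro-Lie). $\mathbf{PAb}_{\mathrm{nA}}$ is the category of non-Archimedean Polish abelian groups and continuous homomorphisms. Short exact sequences are the sequences $0\to A\to B\to C\to 0$ of continuous homomorphisms that are algebraically exact with $A\to B$ a homeomorphism onto a closed subgroup. An object $P$ is projective if $\mathrm{Hom}(P,-)$ maps short exact sequences to short exact sequences of abelian groups. $\mathrm{Ext}(A,B)$ is the group of isomorphism classes of extensions $0\to B\to X\to A\to 0$ of Polish abelian groups, so $\mathrm{Ext}(A,B)=0$ means every such short exact sequence splits via continuous homomorphisms. $\mathbb{Z}^{(\omega)}$ is the free abelian group of countably infinite rank with the discrete topology; powers with exponent $\leq\omega$ carry the product topology. *)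

(* Defs.v *)
From HB Require Import structures.
From mathcomp Require Import all_boot all_order all_algebra.
From mathcomp Require Import all_classical all_reals all_analysis.
From mathcomp Require Export freeg.

Set Implicit Arguments.
Unset Strict Implicit.
Unset Printing Implicit Defensive.

Import Order.TTheory GRing.Theory Num.Theory.

Local Open Scope classical_set_scope.
Local Open Scope ring_scope.

Definition separable (T : topologicalType) : Prop :=
  exists2 D : set T, countable D & dense D.

Definition homeomorphic (T U : topologicalType) : Prop :=
  exists (f : T -> U) (g : U -> T),
    [/\ continuous f, continuous g, cancel f g & cancel g f].

(* The axiom of the library's completeType, which cannot be used directly since
   it bundles a chosen point. *)
Definition complete_space (T : uniformType) : Prop :=
  forall F : set_system T, ProperFilter F -> cauchy F -> exists x : T, F --> x.

Definition completely_metrizable (R : realType) (T : topologicalType) : Prop :=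
  exists2 M : metricType R, complete_space M & homeomorphic T M.

Definition polish (R : realType) (T : topologicalType) : Prop :=
  separable T /\ completely_metrizable R T.

Definition non_archimedean (A : topologicalZmodType) : Prop :=
  forall U : set A, nbhs 0 U ->
    exists H : set A, [/\ nbhs 0 H, zmod_closed (mem H) & H `<=` U].

Definition PAb_nA (R : realType) (A : topologicalZmodType) : Prop :=
  polish R A /\ non_archimedean A.

Section ContinuousHom.
Variables A B : topologicalZmodType.

Definition chom_pred : {pred A -> B} :=
  fun f => `[< continuous f /\ zmod_morphism f >].

Lemma chom_pred_zmod_closed : zmod_closed chom_pred.
Proof.
split=> [|f g /asboolP[fC fA] /asboolP[gC gA]]; apply/asboolP; split.
- by move=> x; exact: cvg_cst.
- by move=> x y; rewrite /= subr0.
- move=> x; apply: (@continuous_comp _ _ _ (fun x => (f x, g x))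
    (fun z : B * B => z.1 - z.2)); last exact: sub_continuous.
  by apply: cvg_pair; [exact: fC|exact: gC].
- by move=> x y; rewrite /= !fctE fA gA opprD !opprK addrACA [in RHS]opprD opprK.
Qed.

HB.instance Definition _ :=
  GRing.isZmodClosed.Build (A -> B) chom_pred chom_pred_zmod_closed.

Record chom := Chom { chom_val :> A -> B; chom_valP : chom_val \in chom_pred }.

HB.instance Definition _ := [isSub for chom_val].
HB.instance Definition _ := [Choice of chom by <:].
HB.instance Definition _ := [SubChoice_isSubZmodule of chom by <:].

Lemma chom_continuous (f : chom) : continuous f.
Proof. by case: f => f /= /asboolP[]. Qed.

Lemma chom_zmod_morphism (f : chom) : zmod_morphism f.
Proof. by case: f => f /= /asboolP[]. Qed.

HB.instance Definition _ (f : chom) := isContinuous.Build A B f (@chom_continuous f).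
HB.instance Definition _ (f : chom) :=
  GRing.isZmodMorphism.Build A B f (@chom_zmod_morphism f).

End ContinuousHom.

Section PostComposition.
Variables P A B : topologicalZmodType.
Variable g : chom A B.

Lemma postcomp_subproof (h : chom P A) : (g \o h) \in @chom_pred P B.
Proof.
apply/asboolP; split=> [x|x y] /=; last by rewrite !raddfB.
by apply: continuous_comp; exact: chom_continuous.
Qed.

Definition postcomp (h : chom P A) : chom P B := Chom (postcomp_subproof h).

Lemma postcomp_zmod_morphism : zmod_morphism postcomp.
Proof. by move=> h k; apply/val_inj/funext => x /=; rewrite raddfB. Qed.

HB.instance Definition _ :=
  GRing.isZmodMorphism.Build (chom P A) (chom P B) postcomp postcomp_zmod_morphism.

End PostComposition.

(* Algebraic exactness only; the topological conditions are in top_short_exact. *)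
Definition short_exact (A B C : zmodType)
    (f : {additive A -> B}) (g : {additive B -> C}) : Prop :=
  [/\ injective f, range f = g @^-1` [set 0] & range g = setT].

Definition homeomorphism_onto_image (A B : topologicalType) (f : A -> B) : Prop :=
  continuous f /\ exists2 g : B -> A, cancel f g & {within range f, continuous g}.

Definition top_short_exact (A B C : topologicalZmodType)
    (f : chom A B) (g : chom B C) : Prop :=
  [/\ short_exact f g, closed (range f) & homeomorphism_onto_image f].

Definition projective (R : realType) (P : topologicalZmodType) : Prop :=
  forall (A B C : topologicalZmodType) (f : chom A B) (g : chom B C),
    PAb_nA R A -> PAb_nA R B -> PAb_nA R C -> top_short_exact f g ->
    short_exact (@postcomp P A B f) (@postcomp P B C g).

Definition top_isomorphic (A B : topologicalZmodType) : Prop :=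
  exists (f : chom A B) (g : chom B A), cancel f g /\ cancel g f.

Section Discrete.
Variable Z : zmodType.

HB.instance Definition _ := GRing.Zmodule.copy (discrete_topology Z) Z.

Lemma discrete_topology_sub_continuous :
  continuous (fun x : discrete_topology Z * discrete_topology Z => x.1 - x.2).
Proof.
move=> [x y]; apply/(discrete_cvg _ _).
exists ([set x], [set y]); first by split; exact: discrete_set1.
by move=> [a b] /= [-> ->].
Qed.

HB.instance Definition _ := PreTopologicalNmodule_isTopologicalZmodule.Build
  (discrete_topology Z) discrete_topology_sub_continuous.

End Discrete.

(* The library's instances on the type of pairs only cover tvsType factors, and
   block the declaration of a topologicalZmodType there; hence the alias. *)
Section DirectSum.
Variables A B : topologicalZmodType.

Definition direct_sum : Type := (A * B)%type.

HB.instance Definition _ := Topological.copy direct_sum (A * B)%type.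
HB.instance Definition _ := GRing.Zmodule.copy direct_sum (A * B)%type.

Lemma direct_sum_sub_continuous :
  continuous (fun x : direct_sum * direct_sum => x.1 - x.2).
Proof.
move=> x.
suff : (fun z : (A * B) * (A * B) => (z.1.1 - z.2.1, z.1.2 - z.2.2)) @ x -->
    (x.1.1 - x.2.1, x.1.2 - x.2.2) by [].
apply: cvg_pair.
- apply: (@continuous_comp _ _ _
    (fun x : (A * B) * (A * B) => (x.1.1, x.2.1)) (fun z : A * A => z.1 - z.2));
    last exact: sub_continuous.
  by apply: cvg_pair; apply: (@continuous_comp _ _ _ _ fst);
    first [exact: cvg_fst|exact: cvg_snd].
- apply: (@continuous_comp _ _ _
    (fun x : (A * B) * (A * B) => (x.1.2, x.2.2)) (fun z : B * B => z.1 - z.2));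
    last exact: sub_continuous.
  by apply: cvg_pair; apply: (@continuous_comp _ _ _ _ snd);
    first [exact: cvg_fst|exact: cvg_snd].
Qed.

HB.instance Definition _ := PreTopologicalNmodule_isTopologicalZmodule.Build
  direct_sum direct_sum_sub_continuous.

Lemma inl_subproof : (fun a : A => (a, 0) : direct_sum) \in @chom_pred A direct_sum.
Proof.
apply/asboolP; split=> [x|x y]; last by congr pair; rewrite subr0.
by apply: (@cvg_pair _ _ _ (nbhs x)); [exact: cvg_id|exact: cvg_cst].
Qed.

Lemma snd_subproof : (fun x : direct_sum => x.2) \in @chom_pred direct_sum B.
Proof. by apply/asboolP; split=> [x|//]; exact: cvg_snd. Qed.

Definition chom_inl : chom A direct_sum := Chom inl_subproof.
Definition chom_snd : chom direct_sum B := Chom snd_subproof.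

End DirectSum.

Section Power.
Variables (I : Type) (A : topologicalZmodType).

Definition power : Type := prod_topology (fun _ : I => A).

HB.instance Definition _ := Topological.on power.
HB.instance Definition _ := GRing.Zmodule.copy power (I -> A).

Lemma power_eval_continuous (i : I) : continuous (fun h : power => h i).
Proof.
move=> h U /= hU; have /cvg_sup/(_ i) : h --> h by exact: cvg_id.
apply; exact: (@initial_continuous _ _ (fun h : power => h i)).
Qed.

Lemma power_sub_continuous : continuous (fun x : power * power => x.1 - x.2).
Proof.
move=> x; apply/cvg_sup => i U [V [[W oW <-] WxV]] VU.
apply: filterS VU _; rewrite /nbhs /=.
have : (fun x : power * power => x.1 i - x.2 i) @ nbhs x --> x.1 i - x.2 i.
  apply: (@continuous_comp _ _ _ (fun x : power * power => (x.1 i, x.2 i))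
    (fun z : A * A => z.1 - z.2)); last exact: sub_continuous.
  apply: cvg_pair.
    apply: (@continuous_comp _ _ _ fst (fun h : power => h i)); first exact: cvg_fst.
    exact: power_eval_continuous.
  apply: (@continuous_comp _ _ _ snd (fun h : power => h i)); first exact: cvg_snd.
  exact: power_eval_continuous.
by apply; apply: open_nbhs_nbhs.
Qed.

HB.instance Definition _ := PreTopologicalNmodule_isTopologicalZmodule.Build
  power power_sub_continuous.

End Power.

Definition is_extension (R : realType) (A B X : topologicalZmodType)
    (i : chom B X) (p : chom X A) : Prop :=
  polish R X /\ top_short_exact i p.

Definition isomorphic_extensions (A B X Y : topologicalZmodType)
    (i : chom B X) (p : chom X A) (j : chom B Y) (q : chom Y A) : Prop :=
  exists (f : chom X Y) (g : chom Y X),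
    [/\ cancel f g, cancel g f, f \o i =1 j & q \o f =1 p].

(* Ext(A, B) = 0: the class of every extension is the zero class, i.e. that of
   0 -> B -> B (+) A -> A -> 0; in other words, every extension splits. *)
Definition Ext_eq0 (R : realType) (A B : topologicalZmodType) : Prop :=
  forall (X : topologicalZmodType) (i : chom B X) (p : chom X A),
    is_extension R i p -> isomorphic_extensions i p (chom_inl B A) (chom_snd B A).

Definition Zdisc : topologicalZmodType := discrete_topology int.
Definition Zomega : topologicalZmodType := discrete_topology {freeg nat / int}.

(* An index set of cardinality alpha <= omega, encoded as [Some n] for alpha = n
   finite and [None] for alpha = omega. *)
Definition index_set (alpha : option nat) : Type :=
  if alpha is Some n then 'I_n else nat.

(* Main.v *)
(* Write P for the product of countably many copies of Z^(omega). Every non-Archimedean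
   Polish abelian group A is a quotient q : P -> A, and q has a continuous section sg
   that need not be a homomorphism. The kernel K of q is closed in P, and every closed
   subgroup of P is a product of countable free groups, one for each step of the
   filtration of P by the vanishing of the first n coordinates.

   (3) => (2): the failure of sg to be additive is a continuous cocycle c with values in
   K, a product of copies of Z and Z^(omega). The coordinates of c define extensions of
   A by Z and Z^(omega) with underlying spaces A x Z and A x Z^(omega), thus Polish, and
   a splitting of these makes c the coboundary of a continuous psi : A -> K. Then
   sg - psi is a continuous homomorphism splitting q, and A is a closed subgroup of P.

   (2) => (1): the group in (2) is a retract of P, and homomorphisms from P lift along a
   surjection g of Polish groups because g is open: the images of the generators are
   lifted to elements that tend to 0.

   (1) => (3): an extension of A by a countable discrete group is again non-Archimedean,
   so that projectivity applies to it. *)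
From HB Require Import structures.
Require Import Defs.
From mathcomp Require Import all_boot all_order all_algebra.
From mathcomp Require Import all_classical all_reals all_analysis.

Set Implicit Arguments.
Unset Strict Implicit.
Unset Printing Implicit Defensive.

Import Order.TTheory GRing.Theory Num.Theory.

Local Open Scope classical_set_scope.
Local Open Scope ring_scope.

(** * Abelian groups *)

(** Reified terms of the language of abelian groups, for a decision procedure by reflection: the
    value of a term depends only on the integer coefficients of its variables, and these compute. *)
Inductive zexpr : Type :=
  ZVar of nat | ZZero | ZAdd of zexpr & zexpr | ZOpp of zexpr.

Fixpoint zeval (A : zmodType) (env : seq A) (e : zexpr) : A :=
  match e with
  | ZVar i => env`_i
  | ZZero => 0
  | ZAdd e1 e2 => zeval env e1 + zeval env e2
  | ZOpp e1 => - zeval env e1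
  end.

Fixpoint zcoef (e : zexpr) (i : nat) : int :=
  match e with
  | ZVar j => Posz (j == i)
  | ZZero => 0
  | ZAdd e1 e2 => zcoef e1 i + zcoef e2 i
  | ZOpp e1 => - zcoef e1 i
  end.

Lemma zevalE (A : zmodType) (env : seq A) e :
  zeval env e = \sum_(i < size env) env`_i *~ zcoef e i.
Proof.
elim: e => [j||e1 ih1 e2 ih2|e1 ih1] /=.
- have [js|js] := ltnP j (size env).
    rewrite (bigD1 (Ordinal js)) //= eqxx big1 ?addr0 // => i ij.
    by case: eqP => [ji|_]; rewrite ?mulr0z //; case/eqP: ij; exact/val_inj.
  rewrite nth_default // big1 // => i _; case: eqP => [ji|_]; last by rewrite mulr0z.
  by move: (ltn_ord i); rewrite ltnNge -ji js.
- by rewrite big1 // => i _; rewrite mulr0z.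
- by rewrite ih1 ih2 -big_split; apply: eq_bigr => i _; rewrite mulrzDr.
- by rewrite ih1 -sumrN; apply: eq_bigr => i _; rewrite mulrNz.
Qed.

Lemma zeval_eq (A : zmodType) (env : seq A) e1 e2 :
  all (fun i => zcoef e1 i == zcoef e2 i) (iota 0 (size env)) ->
  zeval env e1 = zeval env e2.
Proof.
move=> /allP h; rewrite !zevalE; apply: eq_bigr => i _.
by rewrite (eqP (h i _)) // mem_iota /= ltn_ord.
Qed.

Ltac zmem x l :=
  lazymatch l with
  | nil => constr:(false)
  | x :: _ => constr:(true)
  | _ :: ?l' => zmem x l'
  end.

Ltac zenv l t :=
  lazymatch t with
  | (?a + ?b)%R => let l1 := zenv l a in zenv l1 b
  | (- ?a)%R => zenv l a
  | 0%R => l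
  | _ => lazymatch zmem t l with true => l | false => constr:(t :: l) end
  end.

Ltac zindex x l :=
  lazymatch l with
  | x :: _ => constr:(0%N)
  | _ :: ?l' => let n := zindex x l' in constr:(S n)
  end.

Ltac zreify l t :=
  lazymatch t with
  | (?a + ?b)%R => let x := zreify l a in let y := zreify l b in constr:(ZAdd x y)
  | (- ?a)%R => let x := zreify l a in constr:(ZOpp x)
  | 0%R => constr:(ZZero)
  | _ => let n := zindex t l in constr:(ZVar n)
  end.

(* Decides the identities that hold in every abelian group. *)
Ltac zmod :=
  lazymatch goal with
  | |- @eq ?T ?a ?b =>
    let l0 := zenv (@nil T) a in let l := zenv l0 b in
    let x := zreify l a in let y := zreify l b in
    exact: (@zeval_eq _ l x y isT)
  end.

Definition subgroup (A : zmodType) (S : set A) : Prop :=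
  S 0 /\ forall x y, S x -> S y -> S (x - y).

Section SubgroupTheory.
Variables (A : zmodType) (S : set A).
Hypothesis SP : subgroup S.

Lemma subgroup0 : S 0. Proof. by case: SP. Qed.

Lemma subgroupB x y : S x -> S y -> S (x - y). Proof. by case: SP => _; exact. Qed.

Lemma subgroupN x : S x -> S (- x).
Proof. by move=> Sx; rewrite -sub0r; apply: subgroupB => //; exact: subgroup0. Qed.

Lemma subgroupD x y : S x -> S y -> S (x + y).
Proof. by move=> Sx Sy; rewrite -[y]opprK; apply: subgroupB => //; exact: subgroupN. Qed.

Lemma subgroup_mulz x (z : int) : S x -> S (x *~ z).
Proof.
move=> Sx; have Sn n : S (x *+ n).
  by elim: n => [|n ih]; rewrite ?mulr0n ?mulrS; [exact: subgroup0|exact: subgroupD].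
by case: z => n; rewrite ?NegzE ?mulrNz -pmulrn //; exact: subgroupN.
Qed.

Lemma subgroup_sum (I : Type) (r : seq I) (P : pred I) (F : I -> A) :
  (forall i, P i -> S (F i)) -> S (\sum_(i <- r | P i) F i).
Proof. by move=> SF; apply: big_ind => //; [exact: subgroup0|exact: subgroupD]. Qed.

End SubgroupTheory.

(** * Polish groups *)

(** The stage is made part of the state, so that one choice function serves all steps; where the
    invariant [P] fails its value is arbitrary. *)
Lemma dependent_choice (T : Type) (P : nat -> T -> Prop) (N : nat -> T -> T -> Prop)
    (t0 : T) : P 0%N t0 ->
  (forall k t, P k t -> exists2 t', P k.+1 t' & N k t t') ->
  exists t : nat -> T, t 0%N = t0 /\ forall k, P k (t k) /\ N k (t k) (t k.+1).
Proof.
move=> P0 step.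
have /choice[nx nxP] (u : nat * T) : exists t',
    P u.1 u.2 -> P u.1.+1 t' /\ N u.1 u.2 t'.
  have [/step[t' P' N']|nP] := pselect (P u.1 u.2); first by exists t'.
  by exists u.2.
pose fix t k := if k is j.+1 then nx (j, t j) else t0.
have tP k : P k (t k) by elim: k => [//|k ih]; exact: (nxP (k, t k) ih).1.
by exists t; split=> // k; split; [exact: tP|exact: (nxP (k, t k) (tP k)).2].
Qed.

Lemma exists_natSinv_lt (R : realType) (e : R) : 0 < e ->
  exists n : nat, n.+1%:R^-1 < e.
Proof.
move=> e0; have [n _ /(_ n (leqnn n)) h] := near_infty_natSinv_lt (PosNum e0).
by exists n.
Qed.

Lemma polish_dense (R : realType) (X : topologicalType) (x0 : X) : polish R X ->
  exists d : nat -> X, forall (x : X) (W : set X), nbhs x W -> exists k, W (d k).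
Proof.
move=> [[D /countable_injP[f finj] Dd] _].
exists (fun k => xget x0 [set y | D y /\ f y = k]) => x W.
rewrite nbhsE /= => xW; case: xW => [G [oG Gx] GW].
have [y [Gy Dy]] := Dd G (ex_intro _ x Gx) oG.
exists (f y); case: xgetP => [z _ [Dz fz]|/(_ y)[]//].
by apply: GW; rewrite (finj z y) ?inE.
Qed.

Lemma polish_nbhs_basis (R : realType) (X : topologicalType) (x : X) : polish R X ->
  exists N : nat -> set X, [/\ forall n, nbhs x (N n),
    forall W, nbhs x W -> exists n, N n `<=` W &
    forall y, (forall n, N n y) -> y = x].
Proof.
move=> [_ [M _ [f [g [fc gc fK gK]]]]].
exists (fun n => f @^-1` ball (f x) (n.+1%:R^-1)); split.
- by move=> n; apply: fc; apply: nbhsx_ballx; rewrite invr_gt0 ltr0n.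
- move=> W xW; have : nbhs (f x) (g @^-1` W) by apply: gc; rewrite fK.
  move=> /nbhs_ballP[e /= e0 eW]; have [n ne] := exists_natSinv_lt e0.
  exists n => y fy; rewrite -[y]fK; apply: eW; exact: le_ball (ltW ne) _ fy.
- move=> y Ny; apply: (can_inj fK); apply/esym/mdist_positivity/eqP.
  rewrite eq_le mdist_ge0 andbT leNgt; apply/negP => /exists_natSinv_lt[n ne].
  by have := Ny n; rewrite /preimage/= ballEmdist/= ltNge (ltW ne).
Qed.

(* [small n V] says that the diameter of [V] is at most [1 / (n + 1)] for a
   complete metric, which need not be translation invariant. *)
Lemma polish_small (R : realType) (X : topologicalType) : polish R X ->
  exists small : nat -> set X -> Prop, [/\
    forall n V W, V `<=` W -> small n W -> small n V,
    forall n (x : X), exists2 V : set X, nbhs x V & small n V &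
    forall V : nat -> set X, (forall n, V n.+1 `<=` V n) ->
      (forall n, V n !=set0) -> (forall n, small n (V n)) ->
      exists x : X, forall N : set X, nbhs x N -> exists n, V n `<=` N].
Proof.
move=> [_ [M Mc [f [g [fc gc fK gK]]]]].
exists (fun n V => forall x y, V x -> V y -> ball (f x) (n.+1%:R^-1) (f y)).
split.
- by move=> n V W VW sW x y Vx Vy; apply: sW; exact: VW.
(* Half the radius, since two points of the set are compared through the center [f x]. *)
- move=> n x; exists (f @^-1` ball (f x) (n.+1%:R^-1 / 2)).
    by apply: fc; apply: nbhsx_ballx; rewrite divr_gt0 ?invr_gt0 ?ltr0n.
  by move=> y z /= /ball_sym fy fz; rewrite [_^-1]splitr; exact: ball_triangle fz.
(* The images of the sets [V n] generate a Cauchy filter, whose limit is carried back by [g]. *)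
- move=> V Vdec V0 Vs; pose F : set_system M := [set S | exists n, f @` V n `<=` S].
  have Vle m n : (m <= n)%N -> V n `<=` V m.
    by move/subnK <-; elim: (n - m)%N => [//|k ih]; rewrite addSn; exact: subset_trans ih.
  have FF : ProperFilter F.
    split; first by move=> [n fV0]; have [x Vx] := V0 n; apply: fV0; exists x.
    split; first by exists 0%N.
    - move=> P Q [m mP] [n nQ]; exists (maxn m n) => _ [x Vx <-]; split.
        by apply: mP; exists x => //; apply: Vle Vx; exact: leq_maxl.
      by apply: nQ; exists x => //; apply: Vle Vx; exact: leq_maxr.
    - by move=> P Q PQ [n nP]; exists n; exact: subset_trans PQ.
  have /Mc[m Fm] : cauchy F.
    apply: cauchy_exP => e /exists_natSinv_lt[n ne]; have [x Vx] := V0 n.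
    exists (f x), n => _ [y Vy <-]; exact: le_ball (ltW ne) _ (Vs _ _ _ Vx Vy).
  exists (g m) => N /gc/Fm[n nN]; exists n => x Vx.
  by rewrite -[x]fK; apply: nN; exists x.
Qed.

(** * Neighborhoods of zero and complete filtrations by open subgroups *)

Section TopologicalGroup.
Variable A : topologicalZmodType.

Lemma nbhs_shift (a x : A) (N : set A) :
  nbhs (a + x) N -> nbhs x [set y | N (a + y)].
Proof.
have h : (fun y : A => a + y) @ x --> a + x.
  apply: (@continuous_comp _ _ _ (fun y : A => (a, y)) (fun z : A * A => z.1 + z.2)).
    by apply: cvg_pair; [exact: cvg_cst|exact: cvg_id].
  exact: add_continuous.
by move=> /h.
Qed.

Lemma nbhs_to0 (x : A) (N : set A) : nbhs x N -> nbhs 0 [set y | N (x + y)].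
Proof. by rewrite -{1}[x]addr0 => /nbhs_shift. Qed.

Lemma nbhs_from0 (x : A) (N : set A) : nbhs 0 N -> nbhs x [set y | N (y - x)].
Proof.
rewrite -{1}(addNr x) => /nbhs_shift; apply: filterS => y /=.
by rewrite addrC.
Qed.

Lemma nbhs0_sub (N : set A) : nbhs 0 N ->
  exists2 V, nbhs 0 V & forall x y, V x -> V y -> N (x - y).
Proof.
rewrite -{1}(subr0 (0 : A)) => /(@sub_continuous A (0, 0))[[V W] [V0 W0] VW].
exists (V `&` W); first exact: filterI.
by move=> x y [Vx _] [_ Wy]; exact: (VW (x, y)).
Qed.

End TopologicalGroup.

Lemma continuous_from0 (A B : topologicalZmodType) (f : A -> B) :
  zmod_morphism f -> (forall N, nbhs 0 N -> nbhs 0 (f @^-1` N)) -> continuous f.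
Proof.
move=> fB f0 x N /nbhs_to0/f0/(nbhs_from0 x); apply: filterS => y /=.
by rewrite fB addrC subrK.
Qed.

(** The form in which non-Archimedean Polish groups are used below. Starting from the whole group
    leaves stage 0 of the constructions unconstrained. In [na_complete] the rate [U n] survives in
    the limit because open subgroups are closed. *)
Record na_basis (A : topologicalZmodType) (U : nat -> set A) : Prop := NaBasis {
  na_nbhs : forall n, nbhs 0 (U n);
  na_subgroup : forall n, subgroup (U n);
  na_dec : forall n, U n.+1 `<=` U n;
  na_full : forall x, U 0%N x;
  na_small : forall N, nbhs 0 N -> exists n, U n `<=` N;
  na_sep : forall x, (forall n, U n x) -> x = 0;
  na_complete : forall s : nat -> A, (forall n, U n (s n.+1 - s n)) ->
    exists x, forall n, U n (x - s n)
}.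

Section NaBasisTheory.
Variables (A : topologicalZmodType) (U : nat -> set A).
Hypothesis UP : na_basis U.

Lemma na0 n : U n 0. Proof. exact: subgroup0 (na_subgroup UP n). Qed.

Lemma na_subr n x y : U n x -> U n y -> U n (x - y).
Proof. by move=> *; apply: (subgroupB (na_subgroup UP n)). Qed.

Lemma naN n x : U n x -> U n (- x).
Proof. by move=> *; apply: (subgroupN (na_subgroup UP n)). Qed.

Lemma naD n x y : U n x -> U n y -> U n (x + y).
Proof. by move=> *; apply: (subgroupD (na_subgroup UP n)). Qed.

Lemma naBC n x y : U n (x - y) -> U n (y - x).
Proof. by move=> /naN; rewrite opprB. Qed.

Lemma naB_trans n x y z : U n (x - y) -> U n (y - z) -> U n (x - z).
Proof. by move=> /naD h /h; rewrite addrA subrK. Qed.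

Lemma na_le m n : (m <= n)%N -> U n `<=` U m.
Proof.
move/subnK <-; elim: (n - m)%N => [//|k ih].
by rewrite addSn; apply: subset_trans ih; exact: na_dec UP _.
Qed.

Lemma na_coset n x : nbhs x [set y | U n (y - x)].
Proof. exact: nbhs_from0 (na_nbhs UP n). Qed.

Lemma continuous_na (Y : topologicalType) (f : Y -> A) y n : continuous f ->
  \forall z \near y, U n (f z - f y).
Proof. by move=> /(_ y _ (na_coset n (f y))). Qed.

End NaBasisTheory.

(* In the completion, the limit [l] of [s] satisfies [l = y - y'] for some [y] and
   [y'] in [X], as [X] and [l + X] are dense G_delta sets. Concretely, two nested
   sequences of metrically small sets [b + W n] and [b' + W n] with [b - b' = s n]
   are chosen. *)
Lemma polish_complete (R : realType) (X : topologicalZmodType) (W : nat -> set X)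
    (s : nat -> X) : polish R X -> (forall n, nbhs 0 (W n)) ->
  (forall N, nbhs 0 N -> exists n, W n `<=` N) ->
  (forall n m p x, (n <= m)%N -> (m <= p)%N -> W p x ->
     W n (x + (s m - s n)) /\ W n (x - (s m - s n))) ->
  exists x : X, forall N : set X, nbhs x N -> exists n, forall m, (n <= m)%N -> N (s m).
Proof.
move=> Xp W0 Wb sW.
have W00 n : W n 0 by exact: nbhs_singleton.
have Wle m n : (m <= n)%N -> W n `<=` W m.
  by move=> mn x /(sW m m n x (leqnn m) mn)[]; rewrite subrr addr0.
have sle m n : (m <= n)%N -> W m (s n - s m).
  by move=> mn; have [] := sW m n n 0 mn (leqnn n) (W00 n); rewrite add0r.
have [small [smallS smallx smallP]] := polish_small Xp.
have smallU k x m : exists2 p, (m <= p)%N & small k [set y | W p (y - x)].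
  have [V /nbhs_to0/Wb[p pV] sV] := smallx k x.
  exists (maxn m p); first exact: leq_maxl.
  apply: smallS sV => y /(Wle p _ (leq_maxr _ _))/pV /=.
  by rewrite addrC subrK.
pose inv k (t : X * X * nat) := [/\ (k <= t.2)%N,
  small k [set y | W t.2 (y - t.1.1)], small k [set y | W t.2 (y - t.1.2)] &
  t.1.1 - t.1.2 = s t.2].
pose next (t t' : X * X * nat) :=
  [set y | W t'.2 (y - t'.1.1)] `<=` [set y | W t.2 (y - t.1.1)] /\
  [set y | W t'.2 (y - t'.1.2)] `<=` [set y | W t.2 (y - t.1.2)].
have step k (t : X * X * nat) : t.1.1 - t.1.2 = s t.2 ->
    exists2 t', inv k t' & next t t'.
  case: t => [[b b'] n] /= bs.
  have [m nm sm] := smallU k b (maxn n k).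
  have [p mp sp] := smallU k (b - s m) m.
  have [{}nm km] : (n <= m)%N /\ (k <= m)%N by apply/andP; rewrite -geq_max.
  have shift q y : (q <= m)%N -> W p (y - (b + (s p - s m))) -> W q (y - b).
    move=> qm h; apply: Wle qm _ _; have [+ _] := sW m p p _ mp (leqnn p) h.
    by congr W; zmod.
  (* The new first point stays within [W m] of [b], where smallness is secured by the choice of [m].
     The new second point is [b' - (s m - s n)]; it is known before [p], which is then taken large
     enough to make its neighborhood small. *)
  exists ((b + (s p - s m), b - s m), p); split => /=.
  - exact: leq_trans mp.
  - by apply: smallS sm => y; exact: shift.
  - by [].
  - zmod.
  - by move=> y; exact: shift.
  - move=> y /(sW n m p _ nm mp)[_] /=.
    by rewrite -bs; congr W; zmod.
have [t tP] : exists t : nat -> X * X * nat, forall k, inv k (t k) /\ next (t k) (t k.+1).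
  have [t0 i0 _] : exists2 t', inv 0%N t' & next ((s 0%N, 0), 0%N) t'.
    by apply: step => /=; rewrite subr0.
  have [t [_ tP]] := dependent_choice (N := fun=> next) i0 (fun k t it =>
    let: And4 _ _ _ h := it in step k.+1 t h).
  by exists t.
have tinv k : inv k (t k) by case: (tP k).
have [y yP] : exists y : X, forall N : set X, nbhs y N ->
    exists n, [set z | W (t n).2 (z - (t n).1.1)] `<=` N.
  apply: smallP => [n|n|n]; first by case: (tP n) => _ [].
    by exists (t n).1.1; rewrite /= subrr.
  by case: (tinv n).
have [y' yP'] : exists y : X, forall N : set X, nbhs y N ->
    exists n, [set z | W (t n).2 (z - (t n).1.2)] `<=` N.
  apply: smallP => [n|n|n]; first by case: (tP n) => _ [].
    by exists (t n).1.2; rewrite /= subrr.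
  by case: (tinv n).
have tle m n : (m <= n)%N ->
    [set z | W (t n).2 (z - (t n).1.1)] `<=` [set z | W (t m).2 (z - (t m).1.1)] /\
    [set z | W (t n).2 (z - (t n).1.2)] `<=` [set z | W (t m).2 (z - (t m).1.2)].
  move/subnK <-; elim: (n - m)%N => [|k [ih ih']]; first by split.
  rewrite addSn.
  by have [_ [h h']] := tP (k + m)%N; split; [exact: subset_trans ih|exact: subset_trans ih'].
exists (y - y') => N yN.
have [[V V'] [/= yV yV'] VN] := @sub_continuous X (y, y') N yN.
have [k kV] := yP V yV; have [k' kV'] := yP' V' yV'.
pose j := maxn k k'; exists (t j).2 => m jm.
(* A late term is a point of the first shrinking set minus the center of the second, hence close to
   [y - y']. *)
have -> : s m = ((t j).1.1 + (s m - s (t j).2)) - (t j).1.2.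
  by have [_ _ _ <-] := tinv j; zmod.
apply: (VN (_, _)); split=> /=.
  apply: kV; apply: (tle k j (leq_maxl _ _)).1 => /=.
  by rewrite addrC addKr; exact: sle.
by apply: kV'; apply: (tle k' j (leq_maxr _ _)).2; rewrite /= subrr.
Qed.

(** The set [U n] is the intersection of [n] open subgroups taken inside the first [n] members of a
    countable neighborhood basis. The hypothesis of [polish_complete] on increments is then closure
    under sums and differences. *)
Lemma PAb_nA_na_basis (R : realType) (A : topologicalZmodType) :
  PAb_nA R A -> exists U : nat -> set A, na_basis U.
Proof.
move=> [Ap Ana].
have [N [N0 NW Nsep]] := polish_nbhs_basis (0 : A) Ap.
have /choice[H HP] n : exists H : set A,
    [/\ nbhs 0 H, forall x y, H x -> H y -> H (x - y) & H `<=` N n].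
  have [H [H0 [_ HB] HN]] := Ana _ (N0 n); exists H; split=> // x y Hx Hy.
  by apply/set_mem; apply: HB; exact/mem_set.
pose fix U n : set A := if n is k.+1 then U k `&` H k else setT.
have U0 n : nbhs 0 (U n).
  elim: n => [|n ih] /=; first exact: filterT.
  by apply: filterI => //; have [] := HP n.
have Usub n x y : U n x -> U n y -> U n (x - y).
  elim: n => [//|n ih] /= [Ux Hx] [Uy Hy]; split; first exact: ih.
  by have [_ h _] := HP n; exact: h.
have Udec n : U n.+1 `<=` U n by move=> x [].
have UW W : nbhs 0 W -> exists n, U n `<=` W.
  move=> /NW[n nW]; exists n.+1 => x [_ Hx]; apply: nW.
  by have [_ _] := HP n; exact.
have Usep x : (forall n, U n x) -> x = 0.
  move=> Ux; apply: Nsep => n; have [_ _] := HP n; apply.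
  by have [] := Ux n.+1.
have U00 n : U n 0 by exact: nbhs_singleton.
exists U; split=> //; first by move=> n; split; [exact: U00|exact: Usub].
move=> s sU.
have Ule m n : (m <= n)%N -> U n `<=` U m.
  by move/subnK <-; elim: (n - m)%N => [//|k ih]; rewrite addSn; exact: subset_trans ih.
have UN n x : U n x -> U n (- x) by move=> Ux; rewrite -sub0r; exact: Usub.
have UD n x y : U n x -> U n y -> U n (x + y).
  by move=> Ux Uy; rewrite -[y]opprK; apply: Usub => //; exact: UN.
have sle m n : (m <= n)%N -> U m (s n - s m).
  move/subnK <-; elim: (n - m)%N => [|k ih]; first by rewrite subrr.
  rewrite addSn -(subrK (s (k + m)%N) (s _.+1)) -addrA; apply: UD ih.
  by apply: Ule (sU _); rewrite leq_addl.
have [x xP] := polish_complete Ap U0 UW (fun n m p x nm mp Ux =>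
  conj (UD _ _ _ (Ule _ _ (leq_trans nm mp) _ Ux) (sle _ _ nm))
       (Usub _ _ _ (Ule _ _ (leq_trans nm mp) _ Ux) (sle _ _ nm))).
(* A late term lies in the coset of the limit modulo [U n] and also in that of [s n]. *)
exists x => n; have [k kP] := xP _ (nbhs_from0 x (U0 n)).
have := Usub _ _ _ (sle _ _ (leq_maxr k n)) (kP _ (leq_maxl k n)).
by congr U; zmod.
Qed.

(** * The open mapping theorem *)

Section NaSeries.
Variables (A : topologicalZmodType) (U : nat -> set A).
Hypothesis UP : na_basis U.

(** Completeness yields only the rate [U k]; the faster rate [U (n k)] follows by passing through
    the term of index [maxn k (n k)]. *)
Lemma na_nested (s : nat -> A) (n : nat -> nat) :
  (forall k, (k <= n k)%N) -> (forall k, (n k <= n k.+1)%N) ->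
  (forall k, U (n k) (s k.+1 - s k)) -> exists z, forall k, U (n k) (z - s k).
Proof.
move=> nk nS sU.
have [z zP] : exists z, forall k, U k (z - s k).
  by apply: (na_complete UP) => k; apply: (na_le UP (nk k)); exact: sU.
exists z => k.
have nle m j : (m <= j)%N -> (n m <= n j)%N.
  move/subnK <-; elim: (j - m)%N => [//|i ih].
  by rewrite addSn; exact: leq_trans (nS _).
have sle m j : (m <= j)%N -> U (n m) (s j - s m).
  move/subnK <-; elim: (j - m)%N => [|i ih]; first by rewrite subrr; exact: na0.
  rewrite addSn; apply: (naB_trans UP) ih.
  by apply: (na_le UP) (sU _); apply: nle; rewrite leq_addl.
apply: (naB_trans UP) (sle k (maxn k (n k)) (leq_maxl _ _)).
by apply: (na_le UP (leq_maxr k (n k))).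
Qed.

(** The series converges uniformly, so that additivity and continuity pass from the partial sums to
    the limit. Homomorphisms out of infinite products are built in this way. *)
Lemma chom_series (T : topologicalZmodType) (t : nat -> chom T A) :
  (forall n x, U n (t n x)) ->
  exists f : chom T A, forall n x, U n (f x - \sum_(k < n) t k x).
Proof.
move=> tU.
have /choice[f fP] x : exists y, forall n, U n (y - \sum_(k < n) t k x).
  by apply: (na_complete UP) => n; rewrite big_ord_recr /= addrAC subrr add0r.
have fB : zmod_morphism f.
  move=> x y; apply/eqP; rewrite -subr_eq0; apply/eqP/(na_sep UP) => n.
  have := naD UP (na_subr UP (fP (x - y) n) (fP x n)) (fP y n).
  have -> : \sum_(k < n) t k (x - y) = \sum_(k < n) t k x - \sum_(k < n) t k y.
    by rewrite -sumrB; apply: eq_bigr => k _; rewrite raddfB.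
  by congr U; zmod.
have fC : continuous f.
  apply: continuous_from0 => // N /(na_small UP)[n nN].
  have : continuous (\sum_(k < n) t k) by exact: chom_continuous.
  move=> /(_ 0 (U n)); rewrite raddf0 => /(_ (na_nbhs UP n)) Un.
  have {}Un : nbhs 0 ((\sum_(k < n) t k) @^-1` U n) by exact: Un.
  apply: filterS Un => x /= sx; apply: nN; rewrite -(subrK (\sum_(k < n) t k x) (f x)).
  apply: (naD UP) => //; move: sx; congr U.
  by elim/big_rec2: _ => // k y1 y2 _ <-.
have fP' : f \in @chom_pred T A by apply/asboolP.
by exists (Chom fP').
Qed.

End NaSeries.

Lemma polish_cover (R : realType) (X : topologicalZmodType) (V : set X) :
  polish R X -> nbhs 0 V -> exists d : nat -> X, forall x, exists k, V (d k - x).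
Proof.
move=> Xp V0; have [d dP] := polish_dense (0 : X) Xp.
by exists d => x; exact: dP _ _ (nbhs_from0 x V0).
Qed.

(* The image of a neighborhood is somewhere dense by the Baire property of [Y]. *)
Lemma almost_open (R : realType) (X Y : topologicalZmodType) (U : nat -> set Y)
    (p : chom X Y) (V : set X) : polish R X -> na_basis U ->
  (forall y, exists x, p x = y) -> nbhs 0 V ->
  exists n, forall y, U n y -> forall m, exists2 x, V x & U m (y - p x).
Proof.
move=> Xp UP psurj V0; have [V' V'0 V'V] := nbhs0_sub V0.
have [d dP] := polish_cover Xp V'0.
(* [F k] is the closure of the image of [d k - V'], and these translates cover [X]. If some [F k]
   contains a coset of [U n], differences of its points approximate [U n]. *)
pose F k y := forall m, exists2 x, V' x & U m (y - p (d k - x)).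
have [[k [y0 [n nF]]]|nF] :=
    pselect (exists k y0 n, forall y, U n (y - y0) -> F k y).
  exists n => y Uy m.
  have := nF (y + y0); rewrite addrK => /(_ Uy m)[x V'x Ux].
  have := nF y0; rewrite subrr => /(_ (na0 UP n) m)[x' V'x' Ux'].
  exists (x' - x); first exact: V'V.
  by have := na_subr UP Ux Ux'; congr U; rewrite !raddfB /=; zmod.
exfalso.
(* Otherwise every coset of [U n] contains a smaller coset that misses the image of [d k - V'];
   nesting such cosets contradicts surjectivity. The bound [k < m] gives the rate needed for
   [na_nested]. *)
have step k y0 n : exists y m, [/\ U n (y - y0), (k < m)%N, (n <= m)%N &
    forall x, V' x -> ~ U m (y - p (d k - x))].
  have [y [Uy]] : exists y, U n (y - y0) /\ ~ F k y.
    apply: contrapT => h; apply: nF; exists k, y0, n => y Uy.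
    by apply: contrapT => nFy; apply: h; exists y.
  move=> /existsNP[m mF]; exists y, (maxn m (maxn k.+1 n)); split=> //.
  - by rewrite leq_max leq_max leqnn orbT.
  - by rewrite leq_max leq_max leqnn !orbT.
  - move=> x V'x Ux; apply: mF; exists x => //.
    by apply: (na_le UP) Ux; exact: leq_maxl.
(* Stage [j.+1] avoids the [j]-th image; stage 0 avoids nothing. *)
pose P k (t : Y * nat) := (k <= t.2)%N /\
  if k is j.+1 then forall x, V' x -> ~ U t.2 (t.1 - p (d j - x)) else True.
pose N (t t' : Y * nat) := U t.2 (t'.1 - t.1) /\ (t.2 <= t'.2)%N.
have P0 : P 0%N (0, 0%N) by [].
have [k [y0 n] _|t [_ tP]] := dependent_choice (N := fun=> N) P0.
  by have [y [m [? ? ? ?]]] := step k y0 n; exists (y, m).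
have [z zP] : exists z, forall k, U (t k).2 (z - (t k).1).
  by apply: na_nested => // k; have [[? _] [? ?]] := tP k.
have [x xz] := psurj z; have [k V'k] := dP x.
have [[_ nU] _] := tP k.+1; apply: (nU _ V'k); rewrite subKr xz.
by apply: (naBC UP); exact: zP.
Qed.

(** A substitute for a basis of subgroups when the group is only known to be Polish: each passage to
    the next index halves the neighborhood. *)
Lemma symmetric_nbhs_basis (R : realType) (X : topologicalZmodType) (V : set X) :
  polish R X -> nbhs 0 V -> exists W : nat -> set X, [/\ W 0%N = V,
    forall n, nbhs 0 (W n),
    forall N, nbhs 0 N -> exists n, W n `<=` N &
    forall n x y, W n.+1 x -> W n.+1 y -> W n (x + y) /\ W n (x - y)].
Proof.
move=> Xp V0; have [N [N0 NW _]] := polish_nbhs_basis (0 : X) Xp.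
have refine (k : nat) (t : set X) : nbhs 0 t -> exists2 t', nbhs 0 t' &
    t' `<=` N k /\ forall x y, t' x -> t' y -> t (x + y) /\ t (x - y).
  move=> t0; have [t1 t10 t1t] := nbhs0_sub t0.
  have [t2 t20 t2t1] := nbhs0_sub t10.
  exists (t1 `&` t2 `&` N k); first by do 2?apply: filterI.
  split=> [x []//|x y [[t1x t2x] _] [[t1y t2y] _]]; split; last exact: t1t.
  rewrite -[y]opprK; apply: t1t => //; rewrite -sub0r; apply: t2t1 => //.
  exact: nbhs_singleton.
have [k t t0|t [tV tP]] := dependent_choice (P := fun=> nbhs 0)
  (N := fun k t t' => t' `<=` N k /\
    forall x y, t' x -> t' y -> t (x + y) /\ t (x - y)) V0.
  exact: refine.
exists t; split=> //.
- by move=> n; case: (tP n).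
- by move=> S /NW[n nS]; exists n.+1; have [_ [h _]] := tP n; exact: subset_trans nS.
- by move=> n; have [_ [_]] := tP n; exact.
Qed.

(** Successive approximation: the error [y - p (s k)] lies in [U (e k)] and is reduced by a
    correction from [W k.+1]. Only the target carries a basis of subgroups, so that the result
    applies to extensions before they are known to be non-Archimedean. *)
Lemma open_mapping (R : realType) (X Y : topologicalZmodType) (U : nat -> set Y)
    (p : chom X Y) (V : set X) : polish R X -> na_basis U ->
  (forall y, exists x, p x = y) -> nbhs 0 V -> nbhs 0 (p @` V).
Proof.
move=> Xp UP psurj V0; have [V' V'0 V'V] := nbhs0_sub V0.
have [W [WV' W0 Wb WD]] := symmetric_nbhs_basis Xp V'0.
have W00 n : W n 0 by exact: nbhs_singleton.
have WN n x : W n.+1 x -> W n (- x).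
  by move=> Wx; have [_] := WD n 0 x (W00 _) Wx; rewrite sub0r.
have Wdec n : W n.+1 `<=` W n.
  by move=> x Wx; have [+ _] := WD n x 0 Wx (W00 _); rewrite addr0.
have Wle m n : (m <= n)%N -> W n `<=` W m.
  by move/subnK <-; elim: (n - m)%N => [//|k ih]; rewrite addSn; exact: subset_trans ih.
(* On [U (e k)] the image of [W k.+1] is dense; the bound [k <= e k] forces the errors to tend to
   zero. *)
have /choice[e eP] k : exists n, (k <= n)%N /\
    forall y, U n y -> forall m, exists2 x, W k.+1 x & U m (y - p x).
  have [n nP] := almost_open Xp UP psurj (W0 k.+1).
  exists (maxn k n); split; first exact: leq_maxl.
  by move=> y Uy; apply: nP; apply: (na_le UP) Uy; exact: leq_maxr.
apply: filterS (na_nbhs UP (e 0%N)) => y Uy.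
have [|k x Ux|s [s0 sP]] := dependent_choice (t0 := 0)
  (P := fun k x => U (e k) (y - p x)) (N := fun k x x' => W k.+1 (x' - x)).
- by rewrite raddf0 subr0.
- have [x' Wx' Ux'] := (eP k).2 _ Ux (e k.+1).
  exists (x + x'); last by rewrite addrC addKr.
  by move: Ux'; rewrite raddfD /=; congr U; zmod.
(* The last increment is absorbed into [x] at the cost of one index. *)
have sW n m x : (n <= m)%N -> W m x ->
    W n (x + (s m - s n)) /\ W n (x - (s m - s n)).
  move=> /subnK <-; elim: (m - n)%N x => [|j ih] x Wx.
    by rewrite subrr subr0 addr0.
  rewrite addSn in Wx *; have [W1 W2] := WD _ _ _ Wx (sP (j + n)%N).2.
  have [+ _] := ih _ W1; have [_ +] := ih _ W2.
  by move=> h1 h2; split; [move: h2|move: h1]; congr W; zmod.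
have [x xP] : exists x : X, forall N : set X, nbhs x N ->
    exists n, forall m, (n <= m)%N -> N (s m).
  apply: (polish_complete Xp W0 Wb) => n m q x nm mq Wx.
  by apply: sW => //; exact: Wle Wx.
exists x.
  have [n nP] := xP _ (nbhs_from0 x V'0).
  (* As [W 0] is [V'], both [s n] and [s n - x] lie in [V'], so their difference [x] lies in [V]. *)
  have [sV' _] : W 0%N (0 + (s n - s 0%N)) /\ W 0%N (0 - (s n - s 0%N)) by exact: sW.
  rewrite WV' s0 add0r subr0 in sV'.
  by rewrite -(subKr (s n) x); apply: V'V => //; exact: nP.
apply/eqP; rewrite eq_sym -subr_eq0; apply/eqP/(na_sep UP) => n.
have [m mP] := xP _ (@chom_continuous _ _ p x _ (na_coset UP n (p x))).
apply: (naB_trans UP) (mP (maxn m n) (leq_maxl _ _)).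
apply: (na_le UP) (sP (maxn m n)).1.
exact: leq_trans (leq_maxr m n) (eP _).1.
Qed.

(** * Free abelian groups of countable rank *)

Lemma mkchom (A B : topologicalZmodType) (f : A -> B) : continuous f ->
  zmod_morphism f -> exists g : chom A B, g =1 f.
Proof.
move=> fC fB; have fP : f \in @chom_pred A B by apply/asboolP.
by exists (Chom fP).
Qed.

Lemma discrete_continuous (Z : choiceType) (X : topologicalType)
  (f : discrete_topology Z -> X) : continuous f.
Proof.
move=> x N fN; suff : nbhs x (f @^-1` N) by [].
by move=> y ->; exact: nbhs_singleton fN.
Qed.

Lemma power_continuous (Y : topologicalType) (I : Type) (A : topologicalZmodType)
  (f : Y -> power I A) : (forall i, continuous (fun y => f y i)) -> continuous f.
Proof.
move=> fC y; apply/cvg_sup => i U [V [[W oW <-] WxV]] VU.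
by apply: filterS VU _; apply: (fC i y); exact: open_nbhs_nbhs.
Qed.

(** A neighborhood of zero constrains finitely many coordinates, and any weight [w] is bounded on
    these. The weight may take a value several times, which allows grouping coordinates by stage. *)
Lemma power_nbhs0 (I : Type) (A : topologicalZmodType) (w : I -> nat)
    (N : set (power I A)) : nbhs 0 N ->
  exists n, [set x : power I A | forall i, (w i < n)%N -> x i = 0] `<=` N.
Proof.
pose F : set_system (power I A) :=
  [set N | exists n, [set x : power I A | forall i, (w i < n)%N -> x i = 0] `<=` N].
have FF : Filter F.
  split; first by exists 0%N.
  - move=> S T [m mS] [n nT]; exists (maxn m n) => x x0; split.
      by apply: mS => i im; apply: x0; rewrite leq_max im.
    by apply: nT => i im; apply: x0; rewrite leq_max im orbT.
  - by move=> S T ST [n nS]; exists n; exact: subset_trans ST.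
suff : F --> (0 : power I A) by apply.
apply/cvg_sup => i U [V [[W oW <-] W0]] VU.
exists (w i).+1 => x x0; apply: VU => /=.
by rewrite x0.
Qed.

Section FreegLift.
Variables (K : choiceType) (M : zmodType) (b : K -> M).

Definition freeg_lift (D : {freeg K / int}) : M := fglift (b : K -> zmodule M) D.

Lemma freeg_lift_zmod_morphism : zmod_morphism freeg_lift.
Proof. by move=> x y; exact: (@lift_is_additive int K (zmodule M)). Qed.

HB.instance Definition _ := GRing.isZmodMorphism.Build {freeg K / int} M freeg_lift
  freeg_lift_zmod_morphism.

Lemma freeg_liftU z k : freeg_lift << z *g k >> = b k *~ z.
Proof. by rewrite /freeg_lift liftU. Qed.

Lemma freeg_liftE D : freeg_lift D = \sum_(k <- dom D) b k *~ coeff k D.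
Proof.
rewrite -[in LHS](freeg_sumE D) raddf_sum; apply: eq_bigr => k _.
exact: freeg_liftU.
Qed.

End FreegLift.

Lemma freeg_ext (K : choiceType) (M : zmodType) (f g : {freeg K / int} -> M) :
  zmod_morphism f -> zmod_morphism g -> (forall k, f << k >> = g << k >>) -> f =1 g.
Proof.
move=> fB gB fg.
pose F : {additive {freeg K / int} -> M} :=
  HB.pack f (GRing.isZmodMorphism.Build {freeg K / int} M f fB).
pose G : {additive {freeg K / int} -> M} :=
  HB.pack g (GRing.isZmodMorphism.Build {freeg K / int} M g gB).
move=> D; rewrite -(freeg_sumE D) -[f]/(F : _ -> _) -[g]/(G : _ -> _) !raddf_sum.
apply: eq_bigr => k _.
rewrite -[coeff k D]intz -freegU_mulz !raddfMz; congr (_ *~ _); exact: fg.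
Qed.

Lemma int_subgroup (D : set int) : subgroup D ->
  exists2 d, D d & forall z, D z -> exists q, z = q * d.
Proof.
move=> DP.
have [[z Dz z0]|nD] := pselect (exists2 z, D z & z != 0); last first.
  exists 0 => [|z Dz]; first exact: subgroup0 DP.
  exists 0; rewrite mul0r; apply/eqP.
  by apply: contrapT => z0; apply: nD; exists z => //; apply/negP.
pose p k := `[< (0 < k)%N /\ D (Posz k) >].
have pz : exists k, p k.
  exists `|z|%N; apply/asboolP; split; first by rewrite absz_gt0.
  by rewrite abszE; case: (ger0P z) => _ //; exact: subgroupN.
have [d /asboolP[d0 Dd] dmin] := ex_minnP pz.
exists (Posz d) => // x Dx; exists (x %/ d)%Z.
have Dm : D (x %% d)%Z.
  rewrite /modz; apply: (subgroupB DP) => //.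
  by rewrite mulrC -mulrzz; exact: subgroup_mulz.
have d0' : Posz d != 0 by rewrite -lt0n.
suff r0 : (x %% d)%Z = 0 by rewrite [LHS](divz_eq x d) r0 addr0.
case: (x %% d)%Z Dm (modz_ge0 x d0') (ltz_mod x d0') => // j Dj _ jd.
case: j jd Dj => // j jd Dj.
have : (d <= j.+1)%N by apply: dmin; apply/asboolP.
by rewrite leqNgt -ltz_nat; move: jd; rewrite ger0_norm // => ->.
Qed.

(** The counterpart of [index_set] as a predicate on [nat]: a free group of rank [r] is handled as
    the elements of [{freeg nat / int}] supported there. *)
Definition in_index (r : option nat) (k : nat) : bool :=
  if r is Some n then (k < n)%N else true.

Lemma enumerate (T : pointedType) (S : set T) : countable S ->
  exists (r : option nat) (nu : nat -> T), [/\ forall k, in_index r k -> S (nu k),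
    forall j k, in_index r j -> in_index r k -> nu j = nu k -> j = k &
    forall s, S s -> exists2 k, in_index r k & nu k = s].
Proof.
move=> Sc; have [/finite_setP[n Sn]|Sinf] := pselect (finite_set S).
  have /card_set_bijP[f [fS finj fsurj]] : (`I_n #= S)%card by rewrite card_eq_sym.
  exists (Some n), f; split=> /=.
  - by move=> k kn; exact: fS.
  - by move=> j k jn kn; apply: finj; rewrite inE.
  - by move=> s /fsurj[k kn <-]; exists k.
have /card_set_bijP[f [fS finj fsurj]] : ([set: nat] #= S)%card.
  by rewrite card_eq_sym; exact: eq_card_nat.
exists None, f; split=> /=.
- by move=> k _; exact: fS.
- by move=> j k _ _; apply: finj; rewrite inE.
- by move=> s /fsurj[k _ <-]; exists k.
Qed.

(* A basis is obtained from the leading coefficients: for each [j] the coefficients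
   at [j] of the elements of [M] supported in [0 .. j] form a subgroup [d j * int]. *)
Lemma free_subgroup (M : set {freeg nat / int}) : subgroup M ->
  exists (r : option nat) (b : nat -> {freeg nat / int}), [/\
    forall k, in_index r k -> M (b k),
    forall D, (forall k, ~~ in_index r k -> coeff k D = 0) ->
      freeg_lift b D = 0 -> D = 0 &
    forall m, M m -> exists2 D, freeg_lift b D = m &
      forall k, ~~ in_index r k -> coeff k D = 0].
Proof.
move=> MP; pose L j m := M m /\ forall k, (j < k)%N -> coeff k m = 0.
have LB j x y : L j x -> L j y -> L j (x - y).
  move=> [Mx x0] [My y0]; split=> [|k jk]; first exact: subgroupB.
  by rewrite coeffB x0 // y0 // subrr.
have /choice[c cP] j : exists c, L j c /\
    forall m, L j m -> exists q, coeff j m = q * coeff j c.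
  have [|d [c Lc <-] dP] := @int_subgroup [set coeff j m | m in L j].
    split.
      exists 0; rewrite ?coeff0 //.
      by split=> [|k _]; [exact: subgroup0|exact: coeff0].
    by move=> _ _ [x Lx <-] [y Ly <-]; exists (x - y); [exact: LB|exact: coeffB].
  exists c; split=> // m Lm; apply: dP; by exists m.
have [r [nu [nuS nuI nu_surj]]] :=
  @enumerate nat [set j | coeff j (c j) != 0] (countableP _).
exists r, (fun k => c (nu k)); split.
- by move=> k _; have [[]] := cP (nu k).
- move=> D Dr; rewrite freeg_liftE => lD; apply/eqP; rewrite -dom_eq0.
  case E : (dom D) => [//|k0 s].
  have k0D : (0 < size (dom D))%N by rewrite E.
  have idxD k : k \in dom D -> in_index r k.
    by rewrite mem_dom; apply: contraNT => /Dr ->.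
  (* Take the generator in the support of [D] with the highest leading position: no other one
     contributes to the coefficient at that position. *)
  pose i := [arg max_(i > Ordinal k0D | true) nu (nth 0%N (dom D) i)].
  have imax j : j \in dom D -> (nu j <= nu (nth 0%N (dom D) i))%N.
    rewrite /i; case: arg_maxnP => // i0 _ h jD.
    have js : (index j (dom D) < size (dom D))%N by rewrite index_mem.
    by have := h (Ordinal js) isT; rewrite /= nth_index.
  pose k := nth 0%N (dom D) i.
  have kD : k \in dom D by exact: mem_nth.
  have := congr1 (coeff (nu k)) lD.
  rewrite raddf_sum coeff0 (bigD1_seq k) ?uniq_dom //= big_seq_cond big1 ?addr0.
    rewrite raddfMz -mulrzr intz => /eqP; rewrite mulf_eq0.
    have /negPf -> := nuS _ (idxD _ kD).
    by rewrite /= -[_ == 0]negbK -mem_dom kD.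
  move=> j /andP[jD jk]; rewrite raddfMz /=.
  have [[_ c0] _] := cP (nu j); rewrite c0 ?mul0rz //.
  rewrite ltn_neqAle; apply/andP; split.
    apply: contra jk => /eqP/nuI h; apply/eqP/h; exact: idxD.
  exact: imax.
(* Induction on a bound [n] for the support: a multiple of [c n] cancels the top coefficient, and if
   [c n] has none there, neither has [m]. *)
- suff h n m : (forall k, (n <= k)%N -> coeff k m = 0) -> M m ->
      exists2 D, freeg_lift (fun k => c (nu k)) D = m &
      forall k, ~~ in_index r k -> coeff k D = 0.
    move=> m; apply: (h (\max_(k <- dom m) k).+1) => k; apply: contraTeq.
    by rewrite -mem_dom -ltnNge ltnS => km; exact: leq_bigmax_seq.
  elim: n m => [|n ih] m m0 Mm.
    exists 0 => [|k _]; last exact: coeff0.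
    rewrite raddf0; apply/esym/eqP/freeg_eqP => k.
    by rewrite coeff0 m0.
  have Lm : L n m by split.
  have [q qE] := (cP n).2 m Lm.
  have [c0|c0] := eqVneq (coeff n (c n)) 0.
    apply: ih => // k; rewrite leq_eqVlt => /predU1P[<-|]; last exact: m0.
    by rewrite qE c0 mulr0.
  have [k0 k0r k0n] := nu_surj n c0.
  have [||D Dm Dr] := ih (m - c n *~ q).
  - move=> k; rewrite leq_eqVlt => /predU1P[<-|nk].
      by rewrite coeffB raddfMz -mulrzl intz -qE subrr.
    by rewrite coeffB raddfMz /= m0 // (cP n).1.2 // mul0rz subrr.
  - by apply: (subgroupB MP) => //; apply: subgroup_mulz => //; case: (cP n) => [[]].
  exists (D + << q *g k0 >>).
    by rewrite raddfD /= freeg_liftU k0n Dm subrK.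
  move=> k kr; rewrite coeffD Dr // coeffU; case: eqP => [kk|_].
    by rewrite -kk k0r in kr.
  by rewrite mulr0 addr0.
Qed.

(** * Closed subgroups of products of free groups *)

Section Homs.
Variables A B : topologicalZmodType.

Lemma chom_sumE (I : Type) (r : seq I) (P : pred I) (f : I -> chom A B) x :
  (\sum_(i <- r | P i) f i) x = \sum_(i <- r | P i) f i x.
Proof. by elim/big_rec2: _ => // i y1 y2 _ <-. Qed.

Lemma chom_fst_subproof : (fun x : direct_sum A B => x.1) \in @chom_pred (direct_sum A B) A.
Proof. by apply/asboolP; split=> [x|//]; exact: cvg_fst. Qed.

Definition chom_fst : chom (direct_sum A B) A := Chom chom_fst_subproof.

Lemma chom_eval_subproof (I : Type) (i : I) :
  (fun x : power I A => x i) \in @chom_pred (power I A) A.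
Proof. by apply/asboolP; split=> [|//]; exact: power_eval_continuous. Qed.

Definition chom_eval (I : Type) (i : I) : chom (power I A) A :=
  Chom (chom_eval_subproof i).

Lemma chom_disc_subproof (Z : zmodType) (f : {additive Z -> B}) :
  (f : discrete_topology Z -> B) \in @chom_pred (discrete_topology Z) B.
Proof. by apply/asboolP; split=> [|x y]; [exact: discrete_continuous|exact: raddfB]. Qed.

Definition chom_disc (Z : zmodType) (f : {additive Z -> B}) :
  chom (discrete_topology Z) B := Chom (chom_disc_subproof f).

Lemma chom_single_subproof (k : nat) :
  (fun a j => if j == k then a else 0 : A) \in @chom_pred A (power nat A).
Proof.
apply/asboolP; split=> [|x y].
  apply: power_continuous => j; case: eqP => _; first by move=> x; exact: cvg_id.
  by move=> x; exact: cvg_cst.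
by apply/funext => j; rewrite !fctE /=; case: eqP => _; rewrite ?subr0.
Qed.

Definition chom_single (k : nat) : chom A (power nat A) := Chom (chom_single_subproof k).

End Homs.

Section FreegU.
Variables (K : choiceType) (k : K).

Definition freegU (z : int) : {freeg K / int} := << z *g k >>.

Lemma freegU_zmod_morphism : zmod_morphism freegU.
Proof. by move=> x y; rewrite /freegU freegUB. Qed.

HB.instance Definition _ := GRing.isZmodMorphism.Build int {freeg K / int} freegU
  freegU_zmod_morphism.

End FreegU.

Definition index_val (a : option nat) : index_set a -> nat :=
  match a with Some n => @nat_of_ord n | None => id end.

Lemma index_val_inj (a : option nat) : injective (@index_val a).
Proof. by case: a => [n|] /=; [exact: ord_inj|]. Qed.

Lemma in_indexP (a : option nat) k : in_index a k -> exists i : index_set a, index_val i = k.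
Proof. by case: a => [n|] /=; [move=> kn; exists (Ordinal kn)|exists k]. Qed.

Lemma index_valP (a : option nat) (i : index_set a) : in_index a (index_val i).
Proof. by case: a i => [n|] //= i; exact: ltn_ord. Qed.

Lemma enumerate_index (T : pointedType) (S : set T) : countable S ->
  exists (a : option nat) (e : index_set a -> T),
    [/\ injective e, forall i, S (e i) & forall s, S s -> exists i, e i = s].
Proof.
move=> /enumerate[a [nu [nuS nuI nu_surj]]]; exists a, (nu \o @index_val a); split.
- move=> i j /= h; apply: index_val_inj; apply: nuI h; exact: index_valP.
- by move=> i; apply: nuS; exact: index_valP.
- by move=> s /nu_surj[k /in_indexP[i <-] <-]; exists i.
Qed.

Definition partial_inv (I T : Type) (e : I -> T) (t : T) : option I :=
  if pselect (exists i, e i = t) is left h then Some (projT1 (cid h)) else None.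

Lemma partial_invK (I T : Type) (e : I -> T) i : injective e ->
  partial_inv e (e i) = Some i.
Proof.
move=> eI; rewrite /partial_inv; case: pselect => [h|[]]; last by exists i.
by congr Some; apply: eI; case: cid.
Qed.

(** Coordinates are addressed by the codes [t] of the indices under [e]; a code of no index gives
    the zero map, which keeps the function total. *)
Definition chom_coord (I T : Type) (A : topologicalZmodType) (e : I -> T) (t : T) :
    chom (power I A) A :=
  if partial_inv e t is Some i then chom_eval A i else 0.

Lemma chom_coordE (I T : Type) (A : topologicalZmodType) (e : I -> T) i (x : power I A) :
  injective e -> chom_coord A e (e i) x = x i.
Proof. by move=> eI; rewrite /chom_coord partial_invK. Qed.

Definition free_sum (a b : option nat) : topologicalZmodType :=
  direct_sum (power (index_set a) Zdisc) (power (index_set b) Zomega).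

(* The product over [n] of the free groups of rank [r n] is isomorphic to some
   [free_sum a b]; [D n] is its [n]-th projection. *)
Lemma free_sum_projections (r : nat -> option nat) :
  exists (a b : option nat) (D : nat -> chom (free_sum a b) Zomega), [/\
    forall n x k, ~~ in_index (r n) k -> coeff k (D n x : {freeg nat / int}) = 0,
    forall x, (forall n, D n x = 0) -> x = 0,
    forall N, nbhs 0 N -> exists n, forall x, (forall k, (k < n)%N -> D k x = 0) -> N x &
    forall d : nat -> {freeg nat / int},
      (forall n k, ~~ in_index (r n) k -> coeff k (d n) = 0) ->
      exists x, forall n, D n x = d n].
Proof.
(* A stage of finite rank contributes one copy of the integers for each pair [(n, k)] listed by [e];
   a stage of infinite rank, listed by [f], is one copy of [Zomega]. *)
have [a [e [eI eS e_surj]]] := @enumerate_index (nat * nat)%type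
  [set p | exists2 m, r p.1 = Some m & (p.2 < m)%N] (countableP _).
have [b [f [fI fS f_surj]]] := @enumerate_index nat [set n | r n = None] (countableP _).
pose D n : chom (free_sum a b) Zomega := match r n with
  | Some m => \sum_(k < m) postcomp (@chom_disc Zomega int (freegU (nat_of_ord k)))
      (postcomp (chom_coord Zdisc e (n, nat_of_ord k)) (chom_fst _ _))
  | None => postcomp (chom_coord Zomega f n) (chom_snd _ _)
  end.
have DS n m (x : free_sum a b) : r n = Some m -> D n x =
    \sum_(k < m) freegU (nat_of_ord k) (chom_coord Zdisc e (n, nat_of_ord k) x.1).
  by rewrite /D => ->; rewrite chom_sumE.
have DN n x : r n = None -> D n x = chom_coord Zomega f n x.2 by rewrite /D => ->.
have De x i : coeff (e i).2 (D (e i).1 x : {freeg nat / int}) = x.1 i.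
  have [m rm im] := eS i; rewrite (DS _ _ _ rm) raddf_sum (bigD1 (Ordinal im)) //=.
  rewrite coeffU eqxx mulr1 -surjective_pairing chom_coordE // big1 ?addr0 // => j ji.
  rewrite coeffU; case: eqP => [jE|_]; last by rewrite mulr0.
  by case/eqP: ji; exact/val_inj.
have Df x i : D (f i) x = x.2 i by rewrite DN ?chom_coordE //; exact: fS.
exists a, b, D; split.
- move=> n x k; case E : (r n) => [m|//]; rewrite -leqNgt => mk.
  rewrite (DS _ _ _ E) raddf_sum big1 // => i _ /=.
  rewrite coeffU; case: eqP => [ik|_]; last by rewrite mulr0.
  by move: (ltn_ord i); rewrite ik ltnNge mk.
- move=> x Dx; rewrite [x]surjective_pairing; congr pair; apply/funext => i.
    by rewrite -De Dx coeff0.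
  by rewrite -Df Dx.
- move=> N [[N1 N2] [/= N1_0 N2_0] NN].
  (* The weight of a coordinate is the stage to which it belongs. *)
  have [n1 n1P] := power_nbhs0 (fun i => (e i).1) N1_0.
  have [n2 n2P] := power_nbhs0 f N2_0.
  exists (maxn n1 n2) => x Dx; apply: NN; split=> /=.
    by apply: n1P => i i1; rewrite -De Dx ?coeff0 // leq_max i1.
  by apply: n2P => i i1; rewrite -Df Dx // leq_max i1 orbT.
- move=> d dr; exists ((fun i => coeff (e i).2 (d (e i).1)), (fun i => d (f i))) => n.
  case E : (r n) => [m|]; last first.
    by have [i <-] := f_surj n E; rewrite Df.
  rewrite (DS _ _ _ E); apply/eqP/freeg_eqP => k; rewrite raddf_sum /=.
  have [km|mk] := ltnP k m; last first.
    rewrite dr ?E /= -?leqNgt // big1 // => i _.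
    rewrite coeffU; case: eqP => [ik|_]; last by rewrite mulr0.
    by move: (ltn_ord i); rewrite ik ltnNge mk.
  rewrite (bigD1 (Ordinal km)) //= coeffU eqxx mulr1 big1 ?addr0.
    have [i ei] := e_surj (n, k) (ex_intro2 _ _ m E km).
    by rewrite -ei chom_coordE //= ei.
  move=> j jk; rewrite coeffU; case: eqP => [jE|_]; last by rewrite mulr0.
  by case/eqP: jk; exact/val_inj.
Qed.

Definition Pomega : topologicalZmodType := power nat Zomega.

Definition Pbasis (n : nat) : set Pomega := [set x | forall k, (k < n)%N -> x k = 0].

Lemma Pbasis_na_basis : na_basis Pbasis.
Proof.
split.
- elim=> [|n ih]; first exact: filterS filterT.
  have h : nbhs (0 : Pomega) [set x : Pomega | x n = 0].
    exact: (@power_eval_continuous nat Zomega n 0 [set 0] (discrete_set1 _)).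
  apply: filterS (filterI ih h) => x [x0 xn] k.
  by rewrite ltnS leq_eqVlt => /predU1P[->|/x0].
- move=> n; split=> // x y x0 y0 k kn; rewrite -[LHS]/(x k - y k).
  by rewrite x0 // y0 // subrr.
- by move=> n x x0 k kn; apply: x0; exact: ltnW.
- by [].
- by move=> N /(power_nbhs0 id).
- by move=> x x0; apply/funext => k; exact: (x0 k.+1).
(* From the term [s k.+1] on, the coordinate [k] no longer changes. *)
- move=> s sB; exists (fun k => s k.+1 k) => n k kn; rewrite -[LHS]/(s k.+1 k - s n k).
  apply/eqP; rewrite subr_eq0 eq_sym; apply/eqP; elim: n kn => [//|n ih].
  rewrite ltnS leq_eqVlt => /predU1P[->//|kn]; rewrite -(ih kn).
  by apply/eqP; rewrite -subr_eq0; apply/eqP; exact: sB kn.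
Qed.

(** The elements of [K] in [Pbasis n] have as [n]-th coordinates a subgroup of [Zomega], which is
    free; a basis of it is lifted to [K], and [Phi] sums the resulting combinations over [n]. The
    last clause makes the inverse of [Phi] on its image continuous. *)
Lemma closed_subgroup_Pomega (K : set Pomega) : subgroup K ->
  (forall x, (forall n, exists2 y, K y & Pbasis n (x - y)) -> K x) ->
  exists (a b : option nat) (Phi : chom (free_sum a b) Pomega), [/\
    forall x, K (Phi x), forall y, K y -> exists x, Phi x = y, injective Phi &
    forall N, nbhs 0 N -> exists n, forall x, Pbasis n (Phi x) -> N x].
Proof.
move=> KP Kc; have VP := Pbasis_na_basis.
have /choice[r] n : exists (r : option nat), exists B : nat -> Pomega, [/\
    forall k, K (B k) /\ Pbasis n (B k),
    forall D, (forall k, ~~ in_index r k -> coeff k D = 0) ->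
      Pbasis n.+1 (freeg_lift B D) -> D = 0 &
    forall x, K x -> Pbasis n x -> exists2 D, Pbasis n.+1 (x - freeg_lift B D) &
      forall k, ~~ in_index r k -> coeff k D = 0].
  pose M : set {freeg nat / int} := [set x n | x in [set x : Pomega | K x /\ Pbasis n x]].
  have MP : subgroup M.
    split; first by exists 0 => //; split; [exact: subgroup0|exact: na0 VP n].
    move=> _ _ [x [Kx Vx] <-] [y [Ky Vy] <-]; exists (x - y) => //.
    by split; [exact: subgroupB|exact: (na_subr VP)].
  have [r [b [bM binj bsurj]]] := free_subgroup MP.
  have /choice[B BP] k : exists B, [/\ K B, Pbasis n B & in_index r k -> B n = b k].
    have [/bM[x [Kx Vx] xb]|] := boolP (in_index r k); first by exists x.
    by exists 0; split; [exact: subgroup0|exact: na0 VP n|].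
  have liftV D : Pbasis n (freeg_lift B D).
    rewrite freeg_liftE; apply: (subgroup_sum (na_subgroup VP n)) => k _.
    by apply: (subgroup_mulz (na_subgroup VP n)); case: (BP k).
  have liftn D : (forall k, ~~ in_index r k -> coeff k D = 0) ->
      (freeg_lift B D) n = freeg_lift b D.
    move=> Dr; rewrite !freeg_liftE -[LHS]/(chom_eval Zomega n _) raddf_sum.
    apply: eq_bigr => k _; rewrite raddfMz /=.
    have [kr|/Dr->] := boolP (in_index r k); last by rewrite !mulr0z.
    by have [_ _ ->] := BP k.
  exists r, B; split.
  - by move=> k; have [] := BP k.
  - move=> D Dr h; apply: binj => //; rewrite -liftn //; exact: h.
  - move=> x Kx Vx; have [|D Dx Dr] := bsurj (x n); first by exists x.
    exists D => // k; rewrite ltnS leq_eqVlt => /predU1P[->|kn].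
      by rewrite -[LHS]/(x n - freeg_lift B D n) liftn // Dx subrr.
    by rewrite -[LHS]/(x k - freeg_lift B D k) Vx // liftV // subrr.
move=> /choice[B BP].
have [a [b [D [Dr D0 Dnbhs Dsurj]]]] := free_sum_projections r.
pose t n : chom (free_sum a b) Pomega :=
  postcomp (@chom_disc Pomega {freeg nat / int} (freeg_lift (B n))) (D n).
have tK n x : K (t n x) /\ Pbasis n (t n x).
  rewrite /t /= freeg_liftE; have [BK _ _] := BP n.
  split; [apply: (subgroup_sum KP)|apply: (subgroup_sum (na_subgroup VP n))] => k _.
    by apply: (subgroup_mulz KP); case: (BK k).
  by apply: (subgroup_mulz (na_subgroup VP n)); case: (BK k).
have [Phi PhiP] := chom_series VP (fun n x => (tK n x).2).
(* Once the earlier terms vanish, [t k x] agrees with [Phi x] modulo [Pbasis k.+1], so it lies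
   there, and independence gives [D k x = 0]. *)
have PhiD n x : Pbasis n (Phi x) -> forall k, (k < n)%N -> D k x = 0.
  move=> Vx k; elim/ltn_ind: k => k ih kn.
  have [_ + _] := BP k; apply; first exact: Dr.
  rewrite -[freeg_lift _ _]/(t k x) -[t k x](subKr (Phi x)).
  apply: (na_subr VP); first by apply: (na_le VP kn).
  have := PhiP k.+1 x; rewrite big_ord_recr big1 /= ?add0r // => j _.
  by rewrite ih ?raddf0 //; exact: ltn_trans kn.
exists a, b, Phi; split.
- move=> x; apply: Kc => n; exists (\sum_(k < n) t k x) => //.
  by apply: subgroup_sum => // k _; case: (tK k x).
- move=> y Ky.
  (* [z k] is what remains of [y] after [k] terms have cleared its first [k] coordinates. *)
  have [|k z [Kz Vz]|z [z0 zP]] := dependent_choice (t0 := y)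
    (P := fun k z => K z /\ Pbasis k z)
    (N := fun k z z' => exists2 d, z' = z - freeg_lift (B k) d &
       forall j, ~~ in_index (r k) j -> coeff j d = 0).
  + by [].
  + have [BK _ /(_ z Kz Vz)[d dV dr]] := BP k; exists (z - freeg_lift (B k) d).
      split=> //; apply: (subgroupB KP) => //; rewrite freeg_liftE.
      by apply: subgroup_sum => // j _; apply: subgroup_mulz => //; case: (BK j).
    by exists d.
  have /choice[d dP] k : exists d, z k.+1 = z k - freeg_lift (B k) d /\
      forall j, ~~ in_index (r k) j -> coeff j d = 0.
    by have [_ [d ? ?]] := zP k; exists d.
  have [x xd] := Dsurj d (fun k => (dP k).2).
  exists x; apply/eqP; rewrite -subr_eq0; apply/eqP/(na_sep VP) => n.
  have -> : Phi x - y = (Phi x - \sum_(k < n) t k x) - (y - \sum_(k < n) t k x) by zmod.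
  apply: (na_subr VP) => //; have [[_ +] _] := zP n; congr Pbasis.
  elim: n => [|n ih]; first by rewrite big_ord0 subr0.
  have td : freeg_lift (B n) (d n) = t n x by rewrite -xd.
  rewrite (dP n).1 ih td big_ord_recr -[X in _ = _ - X]/(\sum_(k < n) t k x + t n x).
  by zmod.
- apply: raddf_inj => x Px; apply: D0 => n.
  by apply: (PhiD n.+1) => //; rewrite Px; exact: na0 VP _.
- move=> N /Dnbhs[n nN]; exists n => x Vx; apply: nN; exact: PhiD.
Qed.

(** * Resolutions and projectivity *)

Lemma chom_eqP (A B : topologicalZmodType) (f g : chom A B) : f =1 g -> f = g.
Proof. by move=> fg; apply/val_inj/funext. Qed.

Lemma continuousB (Y : topologicalType) (A : topologicalZmodType) (f g : Y -> A) :
  continuous f -> continuous g -> continuous (fun y => f y - g y).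
Proof.
move=> fC gC y; apply: (@continuous_comp _ _ _ (fun y => (f y, g y))
  (fun z : A * A => z.1 - z.2)); last exact: sub_continuous.
by apply: cvg_pair; [exact: fC|exact: gC].
Qed.

Lemma continuousD (Y : topologicalType) (A : topologicalZmodType) (f g : Y -> A) :
  continuous f -> continuous g -> continuous (fun y => f y + g y).
Proof.
move=> fC gC y; apply: (@continuous_comp _ _ _ (fun y => (f y, g y))
  (fun z : A * A => z.1 + z.2)); last exact: add_continuous.
by apply: cvg_pair; [exact: fC|exact: gC].
Qed.

(* The digits of [a] are chosen successively in the countable quotients of [A]; they
   are locally constant, which makes the section continuous. *)
Lemma resolution (A : topologicalZmodType) (U : nat -> set A) (d : nat -> A) :
  na_basis U -> (forall x n, exists k, U n (d k - x)) ->
  exists (q : chom Pomega A) (sg : A -> Pomega),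
    [/\ continuous sg, sg 0 = 0 & forall a, q (sg a) = a].
Proof.
move=> UP dP.
(* The [n]-th factor of [Pomega] is mapped onto the subgroup generated by the points of [d] in
   [U n]; the default 0 keeps all values in [U n]. *)
pose b n k : A := if pselect (U n (d k)) then d k else 0.
have bU n k : U n (b n k) by rewrite /b; case: pselect => h //=; exact: na0 UP n.
pose qn n : chom Pomega A :=
  postcomp (@chom_disc A {freeg nat / int} (freeg_lift (b n))) (chom_eval Zomega n).
have [n x|q qP] := chom_series (t := qn) UP.
  rewrite /qn /= freeg_liftE; apply: (subgroup_sum (na_subgroup UP n)) => k _.
  exact: (subgroup_mulz (na_subgroup UP n)).
(* The selected index depends only on the set, thus only on the coset of [x] modulo [U n.+1]. *)
pose digit n x := xget 0%N [set k | U n.+1 (d k - x)].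
have digitP n x : U n.+1 (d (digit n x) - x).
  by rewrite /digit; case: xgetP => // h; have [k /h] := dP x n.+1.
have digit_eq n x y : U n.+1 (x - y) -> digit n x = digit n y.
  move=> xy; rewrite /digit; congr xget; apply/seteqP; split=> k /= h.
    exact: (naB_trans UP) xy.
  by apply: (naB_trans UP) h _; exact: (naBC UP).
pose rho := fix rho (n : nat) (a : A) {struct n} : A :=
  if n is m.+1 then rho m a - d (digit m (rho m a)) else a.
have rhoU n a : U n (rho n a).
  case: n => [|n] /=; first exact: na_full UP _.
  by apply: (naBC UP).
have rho_near n a a' : U n (a' - a) -> forall m, (m <= n)%N ->
    rho m a' - rho m a = a' - a.
  move=> aa; elim=> [//|m ih] mn /=.
  rewrite (digit_eq m (rho m a') (rho m a)); first by rewrite -(ih (ltnW mn)); zmod.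
  by rewrite (ih (ltnW mn)); apply: (na_le UP mn).
pose sg0 a : Pomega := fun n => << digit n (rho n a) >>.
have sg0C : continuous sg0.
  apply: power_continuous => n a N aN.
  have h : nbhs a [set a' | sg0 a' n = sg0 a n].
    apply: filterS (na_coset UP n.+1 a) => a' /= aa.
    rewrite /sg0; congr (<< _ >>); apply: digit_eq.
    by rewrite (rho_near n.+1).
  suff : nbhs a [set a' | N (sg0 a' n)] by [].
  by apply: filterS h => a' /= ->; exact: nbhs_singleton aN.
have qsg a : q (sg0 a) = a.
  apply/eqP; rewrite -subr_eq0; apply/eqP/(na_sep UP) => n.
  have -> : q (sg0 a) - a = (q (sg0 a) - \sum_(k < n) qn k (sg0 a)) - rho n a.
    suff -> : \sum_(k < n) qn k (sg0 a) = a - rho n a by zmod.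
    elim: n => [|n ih]; first by rewrite big_ord0 subrr.
    rewrite big_ord_recr /= ih; have -> : freeg_lift (b n) (sg0 a n) = d (digit n (rho n a)).
      (* The default branch does not occur: the point [d] selected by the digit is congruent to
         [rho n a] modulo [U n.+1], and [rho n a] lies in [U n]. *)
      rewrite freeg_liftU mulr1z /b; case: pselect => h //=; case: h.
      rewrite -(subrK (rho n a) (d _)); apply: (naD UP) => //.
      exact: (na_dec UP).
    by zmod.
  exact: (na_subr UP).
(* The translation normalizes the section, so that its cocycle will vanish when the first argument
   is 0. *)
exists q, (fun a => sg0 a - sg0 0); split.
- by apply: continuousB => // a; exact: cvg_cst.
- exact: subrr.
- by move=> a; rewrite raddfB /= !qsg subr0.
Qed.

(** As [l] may grow slowly, completeness is applied to the terms of indices [K n] with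
    [n <= l (K n)], whose increments have the required rate. *)
Lemma na_basis_subseq (A : topologicalZmodType) (U : nat -> set A) (l : nat -> nat) :
  na_basis U -> l 0%N = 0%N -> (forall k, (l k <= l k.+1)%N) ->
  (forall n, exists k, (n <= l k)%N) -> na_basis (fun k => U (l k)).
Proof.
move=> UP l0 lS lu; split.
- by move=> n; exact: na_nbhs UP _.
- by move=> n; exact: na_subgroup UP _.
- by move=> n x /(na_le UP (lS n)).
- by move=> x; rewrite l0; exact: na_full UP x.
- move=> N /(na_small UP)[n nN]; have [k nk] := lu n; exists k.
  by move=> x /(na_le UP nk)/nN.
- move=> x Ux; apply: (na_sep UP) => n; have [k nk] := lu n.
  by apply: (na_le UP nk).
- move=> s sU; have /choice[K KP] := lu.
  have lle i j : (i <= j)%N -> (l i <= l j)%N.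
    by move/subnK <-; elim: (j - i)%N => [//|k ih]; rewrite addSn; exact: leq_trans (lS _).
  have sle i j : (i <= j)%N -> U (l i) (s j - s i).
    move/subnK <-; elim: (j - i)%N => [|k ih]; first by rewrite subrr; exact: na0 UP _.
    rewrite addSn; apply: (naB_trans UP) ih; apply: (na_le UP) (sU _).
    by apply: lle; rewrite leq_addl.
  have sP n i j : (n <= l i)%N -> (n <= l j)%N -> U n (s j - s i).
    move=> ni nj; have [/sle h|/ltnW/sle h] := leqP i j; first exact: (na_le UP ni).
    by apply: (naBC UP); apply: (na_le UP nj).
  have [|x xP] := na_complete UP (s := fun n => s (K n)).
    by move=> n; apply: sP => //; exact: leq_trans (KP n.+1).
  by exists x => k; apply: (naB_trans UP) (xP _) _; exact: sP.
Qed.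

(** The generators of the [k]-th factor tend to 0 with [k]. By openness of [g] their images under
    [h] have preimages that tend to 0 as well, and the homomorphisms these define on the factors can
    be summed. *)
Lemma Pomega_lift (B C : topologicalZmodType) (U : nat -> set B) (W : nat -> set C)
    (g : chom B C) : na_basis U -> na_basis W ->
  (forall N, nbhs 0 N -> nbhs 0 (g @` N)) -> (forall c, exists b, g b = c) ->
  forall h : chom Pomega C, exists k : chom Pomega B, forall x, g (k x) = h x.
Proof.
move=> UP WP gopen gsurj h; have VP := Pbasis_na_basis.
pose Q n k := forall x, Pbasis k x -> exists2 b, U n b & g b = h x.
have QS n k : Q n k -> Q n k.+1 by move=> Qn x /(na_dec VP)/Qn.
have Qle n j k : (j <= k)%N -> Q n j -> Q n k.
  by move/subnK <-; elim: (k - j)%N => [//|i ih] /ih; rewrite addSn; exact: QS.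
have Q_ex n : exists k, Q n k.
  have h0 : nbhs 0 (h @^-1` (g @` U n)).
    have := @chom_continuous _ _ h 0 (g @` U n); rewrite raddf0; apply.
    exact/gopen/(na_nbhs UP).
  have [k kP] := na_small VP h0; exists k => x /kP[b Ub gb]; by exists b.
(* [l k] is the best rate available at stage [k], capped by [k] so that a maximum exists; openness
   makes it unbounded. *)
have /choice[l lP] k : exists l, [/\ (l <= k)%N, Q l k &
    forall n, (n <= k)%N -> Q n k -> (n <= l)%N].
  pose p n := `[< (n <= k)%N /\ Q n k >].
  have p0 : exists n, p n.
    exists 0%N; apply/asboolP; split=> // x _; have [b gb] := gsurj (h x).
    by exists b => //; exact: na_full UP b.
  have pk n : p n -> (n <= k)%N by move=> /asboolP[].
  have [l /asboolP[lk Ql] lmax] := ex_maxnP p0 pk.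
  by exists l; split=> // n nk Qn; apply: lmax; apply/asboolP.
have l0 : l 0%N = 0%N by case: (lP 0%N); case: (l 0%N).
have lS k : (l k <= l k.+1)%N.
  have [lk Ql _] := lP k; have [_ _] := lP k.+1; apply; first exact: leqW.
  exact: QS.
have lu n : exists k, (n <= l k)%N.
  have [k Qk] := Q_ex n; exists (maxn n k); have [_ _] := lP (maxn n k); apply.
    exact: leq_maxl.
  by apply: Qle Qk; exact: leq_maxr.
have UlP := na_basis_subseq UP l0 lS lu.
pose single k : chom Zomega Pomega := chom_single Zomega k.
have /choice[b bP] k : exists b : nat -> B,
    forall j, U (l k) (b j) /\ g (b j) = h (single k << j >>).
  have [_ Ql _] := lP k.
  have /choice[b bP] j : exists b, U (l k) b /\ g b = h (single k << j >>).
    have [|b Ub gb] := Ql (single k << j >>); last by exists b.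
    by move=> i ik; rewrite /single /=; case: eqP => // ii; move: ik; rewrite ii ltnn.
  by exists b.
pose t n : chom Pomega B :=
  postcomp (@chom_disc B {freeg nat / int} (freeg_lift (b n))) (chom_eval Zomega n).
have gt n x : g (t n x) = h (single n (x n)).
  apply: (@freeg_ext nat C (fun D => g (freeg_lift (b n) D)) (fun D => h (single n D))).
  - by move=> y z; rewrite !raddfB.
  - by move=> y z; rewrite (raddfB (single n)) raddfB.
  - by move=> k; rewrite freeg_liftU mulr1z; case: (bP n k).
have [n x|k kP] := chom_series (t := t) UlP.
  rewrite /t /= freeg_liftE; apply: (subgroup_sum (na_subgroup UP _)) => k _.
  by apply: (subgroup_mulz (na_subgroup UP _)); case: (bP n k).
exists k => x; apply/eqP; rewrite -subr_eq0; apply/eqP/(na_sep WP) => n.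
have gn : nbhs 0 (g @^-1` W n).
  have := @chom_continuous _ _ g 0 (W n); rewrite raddf0; apply.
  exact: na_nbhs WP n.
have hn : nbhs 0 (h @^-1` W n).
  have := @chom_continuous _ _ h 0 (W n); rewrite raddf0; apply.
  exact: na_nbhs WP n.
have [j jP] := na_small UlP gn; have [i iP] := na_small VP hn.
pose m := maxn i j.
(* The two sides agree on finite partial sums, and both remainders are mapped into [W n]. *)
have -> : g (k x) - h x = g (k x - \sum_(e < m) t e x) -
    h (x - \sum_(e < m) single e (x e)).
  have e : g (\sum_(e < m) t e x) = h (\sum_(e < m) single e (x e)).
    by rewrite !raddf_sum; apply: eq_bigr => e _; exact: gt.
  by rewrite (chom_zmod_morphism g) (chom_zmod_morphism h) e; zmod.
apply: (na_subr WP).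
  by apply: jP; apply: (na_le UlP (leq_maxr i j)).
apply: iP => e ei; rewrite -[LHS]/(chom_eval Zomega e _) raddfB raddf_sum /=.
have em : (e < m)%N by apply: leq_trans ei _; exact: leq_maxl.
rewrite (bigD1 (Ordinal em)) //= eqxx big1 ?addr0 ?subrr // => e' e'e.
by case: eqP => // ee; case/eqP: e'e; exact/val_inj.
Qed.

Lemma chom_tuple (Y A : topologicalZmodType) (I : Type) (f : I -> chom Y A) :
  exists F : chom Y (power I A), forall y i, F y i = f i y.
Proof.
have [| |F FE] := @mkchom Y (power I A) (fun y i => f i y).
- by apply: power_continuous => i; exact: chom_continuous.
- by move=> x y; apply/funext => i; rewrite raddfB.
- by exists F => y i; rewrite FE.
Qed.

Lemma continuous_pair (Y : topologicalType) (A B : topologicalZmodType) (f : Y -> A)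
    (g : Y -> B) : continuous f -> continuous g ->
  continuous (fun y => (f y, g y) : direct_sum A B).
Proof. by move=> fC gC y; apply: cvg_pair; [exact: fC|exact: gC]. Qed.

Lemma chom_pair (Y A B : topologicalZmodType) (f : chom Y A) (g : chom Y B) :
  exists F : chom Y (direct_sum A B), forall y, F y = (f y, g y).
Proof.
have [| |F FE] := @mkchom Y (direct_sum A B) (fun y => (f y, g y)).
- by apply: continuous_pair; exact: chom_continuous.
- by move=> x y; rewrite !raddfB.
- by exists F.
Qed.

(** Odd coordinates receive the copies of [Zomega]. Even ones receive the copies of the integers, as
    multiples of the generator 0, and the coefficient at 0 recovers them. *)
Lemma free_sum_retract (a b : option nat) :
  exists (s : chom (free_sum a b) Pomega) (r : chom Pomega (free_sum a b)),
    forall x, r (s x) = x.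
Proof.
have [s sP] := chom_tuple (fun n => if odd n
  then postcomp (chom_coord Zomega (@index_val b) n./2) (chom_snd _ _)
  else postcomp (@chom_disc Zomega int (freegU 0%N))
    (postcomp (chom_coord Zdisc (@index_val a) n./2) (chom_fst _ _))).
have [r1 r1P] := chom_tuple (fun i : index_set a =>
  postcomp (@chom_disc Zdisc {freeg nat / int} (@coeff int nat 0%N))
    (chom_eval Zomega (index_val i).*2)).
have [r2 r2P] := chom_tuple (fun i : index_set b => chom_eval Zomega (index_val i).*2.+1).
have [r rP] := chom_pair r1 r2.
exists s, r => x; rewrite rP [RHS]surjective_pairing; congr pair; apply/funext => i.
  rewrite r1P /= sP odd_double doubleK /= coeffU eqxx mulr1.
  by rewrite chom_coordE //; exact: index_val_inj.
rewrite r2P /= sP /= odd_double /= uphalf_double.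
by rewrite chom_coordE //; exact: index_val_inj.
Qed.

Lemma chom_id (A : topologicalZmodType) : exists f : chom A A, forall x, f x = x.
Proof. by apply: (@mkchom A A id) => // x; exact: cvg_id. Qed.

Lemma factor_through (Y A B : topologicalZmodType) (f : chom A B) (k : chom Y B) :
  injective f -> homeomorphism_onto_image f -> (forall y, range f (k y)) ->
  exists h : chom Y A, forall y, f (h y) = k y.
Proof.
move=> fI [_ [fi fK fiC]] kf.
have fiK b : range f b -> f (fi b) = b by move=> [x _ <-]; rewrite fK.
have [| |h hE] := @mkchom Y A (fi \o k).
- move=> y N yN; have /subspace_continuousP/(_ (k y) (kf y) N yN) := fiC.
  move=> /chom_continuous h.
  have {}h : nbhs y (k @^-1` [set b | range f b -> N (fi b)]) by exact: h.
  suff : nbhs y [set z | N (fi (k z))] by [].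
  by apply: filterS h => z /=; apply; exact: kf.
- move=> x y; apply: fI; rewrite (chom_zmod_morphism f) /= !fiK //.
  exact: chom_zmod_morphism.
- by exists h => y; rewrite hE /= fiK.
Qed.

(** Left exactness holds for every source; the retraction serves for surjectivity, where a lift of
    [h \o r] is restricted along [s]. *)
Lemma retract_projective (R : realType) (A : topologicalZmodType)
    (s : chom A Pomega) (r : chom Pomega A) : (forall x, r (s x) = x) -> projective R A.
Proof.
move=> rs A0 B C f g A0P BP CP [[fI fg gS] _ fH].
have gsurj c : exists b, g b = c.
  by have [b _ gb] : range g c; [rewrite gS|exists b].
have gf a : g (f a) = 0.
  have : (g @^-1` [set 0]) (f a) by rewrite -fg; exists a.
  by [].
split.
- move=> h k hk; apply: chom_eqP => x; apply: fI.
  by have /(congr1 (fun u : chom A B => u x)) := hk.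
- apply/seteqP; split=> [_ [h _ <-]|k gk].
    by apply: chom_eqP => x; exact: gf.
  have [|h hk] := factor_through (k := k) fI fH.
    move=> x; rewrite fg /=.
    by have /(congr1 (fun u : chom A C => u x)) := gk.
  by exists h => //; exact: chom_eqP.
- apply/seteqP; split=> // h _.
  have [U UP] := PAb_nA_na_basis BP; have [W WP] := PAb_nA_na_basis CP.
  have gopen N : nbhs 0 N -> nbhs 0 (g @` N) by exact: open_mapping BP.1 WP gsurj.
  have [k kP] := Pomega_lift UP WP gopen gsurj (postcomp h r).
  by exists (postcomp k s) => //; apply: chom_eqP => x /=; rewrite kP /= rs.
Qed.

(** * Extensions *)

Definition discrete_metric (R : realType) (Z : choiceType) : Type := Z.

Section DiscreteMetric.
Variables (R : realType) (Z : choiceType).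

HB.instance Definition _ := Choice.copy (discrete_metric R Z) Z.

Let d (x y : discrete_metric R Z) : R := (x != y)%:R.

Lemma discrete_metricxx x : d x x = 0.
Proof. by rewrite /d eqxx. Qed.

Lemma discrete_metric_eq0 x y : d x y = 0 -> x = y.
Proof. by rewrite /d; case: eqP => // _ /eqP; rewrite oner_eq0. Qed.

Lemma discrete_metricC x y : d x y = d y x.
Proof. by rewrite /d eq_sym. Qed.

Lemma discrete_metric_triangle y x z : d x z <= d x y + d y z.
Proof.
rewrite /d; have [->|xy] := eqVneq x y; first by rewrite add0r.
by rewrite -[leLHS]addr0 lerD // ?ler0n // lern1 leq_b1.
Qed.

HB.instance Definition _ := isMetric.Build R (discrete_metric R Z)
  discrete_metricxx discrete_metric_eq0 discrete_metricC discrete_metric_triangle.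

Lemma discrete_metric_ball (x y : discrete_metric R Z) : ball x 1 y -> x = y.
Proof.
by rewrite ballEmdist /= /mdist /= /d; case: eqP => // _; rewrite ltxx.
Qed.

End DiscreteMetric.

Lemma discrete_polish (R : realType) (Z : choiceType) (f : Z -> nat) :
  injective f -> polish R (discrete_topology Z).
Proof.
move=> fI; split.
  exists setT; last by move=> O [x Ox] _; exists x.
  by apply/countable_injP; exists f => x y _ _; exact: fI.
exists (discrete_metric R Z).
  move=> F FF /cauchyP/(_ 1 ltr01)[x xF]; exists x => N xN; apply: filterS xF => y.
  by move=> /discrete_metric_ball <-; exact: nbhs_singleton xN.
exists (fun x => x), (fun x => x); split=> //; first exact: discrete_continuous.
move=> x N xN; suff : nbhs (x : discrete_metric R Z) N by [].
apply: filterS (nbhsx_ballx (x : discrete_metric R Z) 1 ltr01) => y.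
by move=> /discrete_metric_ball <-; exact: nbhs_singleton xN.
Qed.

Section ProductMetric.
Variables (R : realType) (M N : metricType R).

(** The maximum metric has products of balls as its balls, which matches the pseudometric structure
    already present on pairs. *)
Let d (x y : M * N) : R := Num.max (mdist x.1 y.1) (mdist x.2 y.2).

Lemma product_metric_ge0 x y : 0 <= d x y.
Proof. by rewrite le_max mdist_ge0. Qed.

Lemma product_metric_eq0 x y : d x y = 0 -> x = y.
Proof.
move=> d0; have : d x y <= 0 by rewrite d0.
rewrite ge_max => /andP[d1 d2]; rewrite [x]surjective_pairing [y]surjective_pairing.
by congr pair; apply/mdist_positivity/eqP; rewrite eq_le mdist_ge0 ?d1 ?d2.
Qed.

Lemma product_metric_ball x e : ball x e = [set y | d x y < e].
Proof.
apply/seteqP; split=> y; rewrite /= /d gt_max.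
  by case; rewrite !ballEmdist /= => -> ->.
by move=> /andP[h1 h2]; split; rewrite ballEmdist.
Qed.

HB.instance Definition _ := PseudoMetric_isMetric.Build R (M * N)%type
  product_metric_ge0 product_metric_eq0 product_metric_ball.

End ProductMetric.

Lemma polish_prod (R : realType) (X Y : topologicalType) :
  polish R X -> polish R Y -> polish R (X * Y)%type.
Proof.
move=> [[D Dc Dd] [M Mc [f [g [fC gC fK gK]]]]].
move=> [[E Ec Ed] [N Nc [h [k [hC kC hK kK]]]]]; split.
  exists (D `*` E); first exact: countableX.
  move=> O [[x y] Oxy] oO; have [[V W] [/= xV yW] VW] := open_nbhs_nbhs (conj oO Oxy).
  move: xV yW; rewrite !nbhsE => - [V' [oV' V'x] V'V] [W' [oW' W'y] W'W].
  have [a [V'a Da]] := Dd V' (ex_intro _ x V'x) oV'.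
  have [b [W'b Eb]] := Ed W' (ex_intro _ y W'y) oW'.
  by exists (a, b); split=> //; apply: VW; split; [exact: V'V|exact: W'W].
exists (M * N)%type.
  move=> F FF /cauchyP Fc.
  have ballP (x : M * N) e : ball x e `<=` [set y | ball x.1 e y.1 /\ ball x.2 e y.2] by [].
  have [m Fm] : exists m : M, (@fst M N) @ F --> m.
    apply: Mc; apply: cauchy_exP => e /Fc[x Fx]; exists x.1.
    have hF : F [set y | ball x.1 e y.1] by apply: filterS Fx => y /ballP[].
    exact: hF.
  have [n Fn] : exists n : N, (@snd M N) @ F --> n.
    apply: Nc; apply: cauchy_exP => e /Fc[x Fx]; exists x.2.
    have hF : F [set y | ball x.2 e y.2] by apply: filterS Fx => y /ballP[].
    exact: hF.
  exists (m, n) => S [[V W] [/= /Fm FV /Fn FW] VW].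
  have {}FV : F [set z | V z.1] by exact: FV.
  have {}FW : F [set z | W z.2] by exact: FW.
  suff : F S by [].
  by apply: filterS (filterI FV FW) => y yVW; exact: VW.
exists (fun x => (f x.1, h x.2)), (fun x => (g x.1, k x.2)); split.
- move=> x; apply: cvg_pair.
    by apply: (@continuous_comp _ _ _ fst f); [exact: cvg_fst|exact: fC].
  by apply: (@continuous_comp _ _ _ snd h); [exact: cvg_snd|exact: hC].
- move=> x; apply: cvg_pair.
    by apply: (@continuous_comp _ _ _ fst g); [exact: cvg_fst|exact: gC].
  by apply: (@continuous_comp _ _ _ snd k); [exact: cvg_snd|exact: kC].
- by move=> [x y] /=; rewrite fK hK.
- by move=> [x y] /=; rewrite gK kK.
Qed.

Lemma freeg_countable : exists f : {freeg nat / int} -> nat, injective f.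
Proof.
exists (fun D => pickle (val (repr D))) => D E.
move=> /(pcan_inj pickleK)/val_inj DE.
by rewrite -[D]reprK -[E]reprK DE.
Qed.

Lemma discrete_PAb_nA (R : realType) (Z : zmodType) (f : Z -> nat) :
  injective f -> PAb_nA R (discrete_topology Z).
Proof.
move=> fI; split; first exact: discrete_polish fI.
move=> U U0; exists [set 0]; split; first exact: discrete_set1.
  split; first exact/mem_set.
  by move=> x y /set_mem -> /set_mem ->; apply/mem_set; exact: subr0.
by move=> x ->; exact: nbhs_singleton U0.
Qed.

Lemma Zdisc_PAb_nA (R : realType) : PAb_nA R Zdisc.
Proof. exact: (@discrete_PAb_nA R int pickle (pcan_inj pickleK)). Qed.

Lemma Zomega_PAb_nA (R : realType) : PAb_nA R Zomega.
Proof. by have [f fI] := freeg_countable; exact: discrete_PAb_nA fI. Qed.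

(* The kernel being discrete, [p] restricts to a homeomorphism from a neighborhood of
   [0] in [X] to an open subgroup of [A]. *)
Lemma extension_non_archimedean (R : realType) (A X : topologicalZmodType) (Z : zmodType)
    (i : chom (discrete_topology Z) X) (p : chom X A) (U : nat -> set A) :
  na_basis U -> polish R X -> top_short_exact i p -> non_archimedean X.
Proof.
move=> UP Xp [[iI ip pS] _ [_ [j iK jC]]] N N0.
have i0 : range i 0 by exists 0 => //; exact: raddf0.
(* [V] meets the kernel of [p] only in 0, as the kernel is discrete. *)
have [V V0 Vi] : exists2 V, nbhs (0 : X) V & forall x, V x -> p x = 0 -> x = 0.
  exists [set x | range i x -> j x = 0].
    have j0 : j 0 = 0 by rewrite -(raddf0 i) iK.
    have n0 : nbhs (j 0) [set (0 : discrete_topology Z)] by rewrite j0; exact: discrete_set1.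
    by have /subspace_continuousP/(_ 0 i0 [set 0] n0) := jC.
  move=> x Vx px; have [z _ zx] : range i x by rewrite ip.
  by rewrite -zx -(iK z) zx Vx ?raddf0 //; exists z.
have psurj a : exists x, p x = a.
  by have [x _ px] : range p a; [rewrite pS|exists x].
have [W1 W10 W1V] := nbhs0_sub V0; have [W2 W20 W2W1] := nbhs0_sub W10.
pose W := W1 `&` W2 `&` N.
have W0 : nbhs 0 W by do 2?apply: filterI.
have [n nW] := na_small UP (open_mapping Xp UP psurj W0).
exists (W `&` p @^-1` U n); split.
- apply: filterI => //; have := @chom_continuous _ _ p 0 (U n).
  by rewrite raddf0; apply; exact: na_nbhs UP n.
- split.
    by apply/mem_set; split; [exact: nbhs_singleton|rewrite /= raddf0; exact: na0 UP n].
  move=> x y /set_mem[[[W1x W2x] Nx] Ux] /set_mem[[[W1y W2y] Ny] Uy].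
  apply/mem_set; have Uxy : U n (p (x - y)).
    by rewrite (chom_zmod_morphism p); apply: (na_subr UP).
  (* [x - y] and [z] have the same image and differ by an element of [V], so they are equal and
     [x - y] inherits membership in [W]. *)
  have [z Wz pz] := nW _ Uxy; split=> //.
  suff -> : x - y = z by [].
  apply/eqP; rewrite -subr_eq0; apply/eqP/Vi.
    by apply: W1V; [exact: W2W1|case: Wz => [[]]].
  by rewrite (chom_zmod_morphism p) pz subrr.
- by move=> x [[]].
Qed.

(** The component in [B] is [x - s (p x)], which lies in the kernel of [p] and hence factors
    continuously through [i]. *)
Lemma split_extension (A B X : topologicalZmodType) (i : chom B X) (p : chom X A)
    (s : chom A X) : top_short_exact i p -> (forall a, p (s a) = a) ->
  isomorphic_extensions i p (chom_inl B A) (chom_snd B A).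
Proof.
move=> [[iI ip pS] _ iH] ps.
have {}iI : injective (chom_val i) := iI.
have [id1 id1E] := chom_id X.
have pi b : p (i b) = 0.
  have : (p @^-1` [set 0]) (i b) by rewrite -ip; exists b.
  by [].
have kE x : (id1 - postcomp s p) x = id1 x - s (p x) by [].
have [|h hE] := factor_through (k := id1 - postcomp s p) iI iH.
  move=> x; rewrite ip kE /= (chom_zmod_morphism p) ps.
  by rewrite id1E subrr.
have {}hE x : i (h x) = x - s (p x) by rewrite hE kE id1E.
have [f fE] := chom_pair h p.
pose g : chom (direct_sum B A) X := postcomp i (chom_fst B A) + postcomp s (chom_snd B A).
have gE y : g y = i y.1 + s y.2 by [].
exists f, g; split.
- by move=> x; rewrite gE fE /= hE subrK.
- move=> [b a]; rewrite gE /= fE.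
  have pE : p (i b + s a) = a by rewrite raddfD /= pi ps add0r.
  congr pair => //; apply: iI; rewrite hE pE addrK //.
- move=> b; rewrite /= fE /= pi; congr pair; apply: iI; rewrite hE pi raddf0 subr0 //.
- by move=> x; rewrite /= fE.
Qed.

Lemma projective_Ext_eq0 (R : realType) (A : topologicalZmodType) (Z : zmodType) :
  PAb_nA R A -> PAb_nA R (discrete_topology Z) -> projective R A ->
  Ext_eq0 R A (discrete_topology Z).
Proof.
move=> AP ZP Aproj X i p [Xp ex]; have [U UP] := PAb_nA_na_basis AP.
have XP : PAb_nA R X by split=> //; exact: extension_non_archimedean UP Xp ex.
have [_ _ psurj] := Aproj _ _ _ i p ZP XP AP ex.
have [id1 id1E] := chom_id A.
have [s _ sE] : range (postcomp (P := A) p) id1 by rewrite psurj.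
apply: (split_extension (s := s)) => // a.
by rewrite -[RHS]id1E -sE.
Qed.

(** * Continuous cocycles and the extensions they define *)

Record cocycle (A G : topologicalZmodType) := Cocycle {
  cocycle_fun :> A -> A -> G;
  cocycle_continuous : continuous (fun x : A * A => cocycle_fun x.1 x.2);
  cocycleC : forall x y, cocycle_fun x y = cocycle_fun y x;
  cocycleA : forall x y z, cocycle_fun x y + cocycle_fun (x + y) z =
    cocycle_fun y z + cocycle_fun x (y + z);
  cocycle0 : forall x, cocycle_fun 0 x = 0
}.

Lemma cocycle_comp (A G H : topologicalZmodType) (c : cocycle A G) (f : chom G H) :
  exists c' : cocycle A H, forall x y, c' x y = f (c x y).
Proof.
have fD x y : f (x + y) = f x + f y by exact: raddfD.
have cC : continuous (fun x : A * A => f (c x.1 x.2)).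
  move=> x; apply: (@continuous_comp _ _ _ (fun x : A * A => c x.1 x.2) f).
    exact: cocycle_continuous.
  exact: chom_continuous.
have cS x y : f (c x y) = f (c y x) by rewrite cocycleC.
have cA x y z : f (c x y) + f (c (x + y) z) = f (c y z) + f (c x (y + z)).
  by rewrite -!fD cocycleA.
have c0 x : f (c 0 x) = 0 by rewrite cocycle0 raddf0.
by exists (@Cocycle A H (fun x y => f (c x y)) cC cS cA c0).
Qed.

(** The product space with the addition deformed by [c]. Symmetry of [c] makes it commutative, and
    normalization makes [(0, 0)] its zero. *)
Definition twisted (A G : topologicalZmodType) (c : cocycle A G) : Type := (A * G)%type.

Section Twisted.
Variables (A G : topologicalZmodType) (c : cocycle A G).

HB.instance Definition _ := Topological.copy (twisted c) (A * G)%type.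

Definition twisted_add (x y : twisted c) : twisted c :=
  (x.1 + y.1, x.2 + y.2 + c x.1 y.1).
Definition twisted_opp (x : twisted c) : twisted c := (- x.1, - x.2 - c x.1 (- x.1)).

Lemma twisted_addA : associative twisted_add.
Proof.
move=> x y z; congr pair => /=; first exact: addrA.
have -> : x.2 + (y.2 + z.2 + c y.1 z.1) + c x.1 (y.1 + z.1) =
  x.2 + y.2 + z.2 + (c y.1 z.1 + c x.1 (y.1 + z.1)) by zmod.
by rewrite -cocycleA; zmod.
Qed.

Lemma twisted_addC : commutative twisted_add.
Proof.
move=> x y; congr pair => /=; first exact: addrC.
by rewrite cocycleC (addrC x.2).
Qed.

Lemma twisted_add0 : left_id ((0, 0) : twisted c) twisted_add.
Proof. by case=> x g; congr pair => /=; rewrite ?cocycle0 ?add0r ?addr0. Qed.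

Lemma twisted_addN : left_inverse ((0, 0) : twisted c) twisted_opp twisted_add.
Proof.
move=> x; congr pair => /=; first exact: addNr.
by rewrite (cocycleC c (- x.1)); zmod.
Qed.

HB.instance Definition _ := GRing.isZmodule.Build (twisted c)
  twisted_addA twisted_addC twisted_add0 twisted_addN.

Lemma twisted_sub_continuous :
  continuous (fun x : twisted c * twisted c => x.1 - x.2).
Proof.
have c1 : continuous (fun z : (A * G) * (A * G) => z.1.1).
  by move=> z; apply: (@continuous_comp _ _ _ fst fst); [exact: cvg_fst|exact: cvg_fst].
have c2 : continuous (fun z : (A * G) * (A * G) => z.1.2).
  by move=> z; apply: (@continuous_comp _ _ _ fst snd); [exact: cvg_fst|exact: cvg_snd].
have c3 : continuous (fun z : (A * G) * (A * G) => z.2.1).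
  by move=> z; apply: (@continuous_comp _ _ _ snd fst); [exact: cvg_snd|exact: cvg_fst].
have c4 : continuous (fun z : (A * G) * (A * G) => z.2.2).
  by move=> z; apply: (@continuous_comp _ _ _ snd snd); [exact: cvg_snd|exact: cvg_snd].
have c5 : continuous (fun z : (A * G) * (A * G) => - z.2.1).
  by move=> z; apply: (@continuous_comp _ _ _ (fun z => z.2.1) -%R);
    [exact: c3|exact: opp_continuous].
have c6 : continuous (fun z : (A * G) * (A * G) => - z.2.2).
  by move=> z; apply: (@continuous_comp _ _ _ (fun z => z.2.2) -%R);
    [exact: c4|exact: opp_continuous].
have cc (f g : (A * G) * (A * G) -> A) : continuous f -> continuous g ->
    continuous (fun z => c (f z) (g z)).
  move=> fC gC z; apply: (@continuous_comp _ _ _ (fun z => (f z, g z))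
    (fun x : A * A => c x.1 x.2)); last exact: cocycle_continuous.
  by apply: cvg_pair; [exact: fC|exact: gC].
move=> x.
suff : (fun z : (A * G) * (A * G) => (z.1.1 - z.2.1,
    z.1.2 + (- z.2.2 - c z.2.1 (- z.2.1)) + c z.1.1 (- z.2.1))) @ x -->
    (x.1.1 - x.2.1, x.1.2 + (- x.2.2 - c x.2.1 (- x.2.1)) + c x.1.1 (- x.2.1)) by [].
apply: cvg_pair; first exact: (continuousB c1 c3).
apply: (continuousD (f := fun z : (A * G) * (A * G) =>
  z.1.2 + (- z.2.2 - c z.2.1 (- z.2.1)))); last exact: cc.
apply: continuousD => //; apply: continuousB => //; exact: cc.
Qed.

HB.instance Definition _ := PreTopologicalNmodule_isTopologicalZmodule.Build
  (twisted c) twisted_sub_continuous.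

Lemma twistedD (x y : twisted c) : x + y = (x.1 + y.1, x.2 + y.2 + c x.1 y.1).
Proof. by []. Qed.

End Twisted.

(** A splitting provides a retraction of the twisted group onto [G]. Its values [psi a] at the
    points [(a, 0)] work because [(a, 0) + (b, 0)] is [(a + b, 0)] plus the image of [c a b]. *)
Lemma Ext_eq0_coboundary (R : realType) (A G : topologicalZmodType) (c : cocycle A G) :
  polish R A -> polish R G -> Ext_eq0 R A G ->
  exists2 psi : A -> G, continuous psi &
    forall a b, psi a + psi b = psi (a + b) + c a b.
Proof.
move=> Ap Gp ext; pose X : topologicalZmodType := twisted c.
have c0 x : c x 0 = 0 by rewrite cocycleC cocycle0.
have [||i iE] := @mkchom G X (fun g => (0, g)).
- by move=> g; apply: cvg_pair; [exact: cvg_cst|exact: cvg_id].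
- move=> g h; apply: (@addIr X (0, h)); rewrite subrK twistedD /= c0.
  by congr pair; rewrite ?addr0 // subrK.
have [||p pE] := @mkchom X A fst; [by move=> x; exact: cvg_fst|by []|].
have Xp : polish R X by exact: polish_prod.
(* The point 0 is closed in [A], whence the kernel of [p] is closed. *)
have A_sep (a : A) : (forall N, nbhs a N -> N 0) -> a = 0.
  have [N [Na _ Nsep]] := polish_nbhs_basis a Ap => aN; apply/esym/Nsep => n.
  exact: aN.
have ex : top_short_exact i p.
  have ip : range i = p @^-1` [set 0].
    apply/seteqP; split=> [_ [g _ <-]|[a g]]; first by rewrite /= pE iE.
    by rewrite /= pE /= => ->; exists g => //; rewrite iE.
  split.
  - split=> //; first by move=> g h gh; have : i g = i h by []; rewrite !iE => - [].
    by apply/seteqP; split=> // a _; exists (a, 0) => //; exact: pE.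
  - rewrite ip; apply: preimage_closed; first by move=> x _; exact: chom_continuous.
    move=> a aN; apply: A_sep => N /aN[b [/= -> ]] //.
  - split; first exact: chom_continuous.
    exists snd; first by move=> g; rewrite iE.
    by apply: continuous_subspaceT => x; exact: cvg_snd.
have [f [g [fK gK fi pf]]] := ext X i p (conj Xp ex).
exists (fun a => (f ((a, 0) : X)).1).
  move=> a; apply: (@continuous_comp _ _ _ (fun a : A => (a, 0) : X) (fun x => (f x).1)).
    by apply: cvg_pair; [exact: cvg_id|exact: cvg_cst].
  apply: (@continuous_comp _ _ _ f fst); first exact: chom_continuous.
  exact: cvg_fst.
move=> a b; have -> : c a b = (f (i (c a b))).1 by have := fi (c a b); rewrite /= => ->.
pose u : X := (a, 0); pose v : X := (b, 0); pose w : X := (a + b, 0).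
have fD (x y : X) : (f (x + y)).1 = (f x).1 + (f y).1 by rewrite raddfD.
rewrite -[(f (a, 0)).1]/((f u).1) -[(f (b, 0)).1]/((f v).1) -[(f (a + b, 0)).1]/((f w).1).
rewrite -!fD; congr (f _).1; rewrite iE !twistedD /= c0; congr pair; first by rewrite addr0.
by rewrite !addr0 !add0r.
Qed.

(** * Splitting the resolution *)

Lemma lift_continuous (T P : topologicalZmodType) (V : nat -> set P) (Phi : chom T P)
    (Y : topologicalType) (F : Y -> T) : na_basis V ->
  (forall N, nbhs 0 N -> exists n, forall x, V n (Phi x) -> N x) ->
  continuous (fun y => Phi (F y)) -> continuous F.
Proof.
(* The second hypothesis lets [Phi] reflect smallness; it is applied to the differences
   [F z - F y]. *)
move=> VP Phi_open PhiF y N /nbhs_to0/Phi_open[n nN].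
have h := continuous_na VP (f := fun y => Phi (F y)) y n PhiF.
suff : nbhs y [set z | N (F z)] by [].
apply: filterS h => z Vz; have := nN (F z - F y).
by rewrite (chom_zmod_morphism Phi) => /(_ Vz) /=; rewrite addrC subrK.
Qed.

(** The range of [s] is the set of fixed points of the continuous idempotent [s \o q], hence a
    closed subgroup of [Pomega]. *)
Lemma split_Pomega_free_sum (A : topologicalZmodType) (s : chom A Pomega)
    (q : chom Pomega A) : (forall a, q (s a) = a) ->
  exists a b, top_isomorphic A (free_sum a b).
Proof.
move=> qs; have VP := Pbasis_na_basis.
have [||a [b [Phi [PhiK KPhi PhiI Phi_open]]]] := @closed_subgroup_Pomega (range s).
- split; first by exists 0 => //; rewrite raddf0.
  by move=> _ _ [x _ <-] [y _ <-]; exists (x - y) => //; rewrite raddfB.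
- move=> x xP; exists (q x) => //; apply/eqP; rewrite eq_sym -subr_eq0.
  apply/eqP/(na_sep VP) => n.
  have h : nbhs 0 ((postcomp s q) @^-1` Pbasis n).
    have := @chom_continuous _ _ (postcomp s q) 0 (Pbasis n); rewrite raddf0; apply.
    exact: na_nbhs VP n.
  have [m mP] := na_small VP h; have [_ [a _ <-] xa] := xP (maxn m n).
  (* The defect [x - s (q x)] is unchanged when a point [s a] of the range close to [x] is
     subtracted. *)
  have -> : x - s (q x) = (x - s a) - postcomp s q (x - s a).
    by rewrite /= (chom_zmod_morphism q) qs (chom_zmod_morphism s); zmod.
  apply: (na_subr VP); first exact: (na_le VP (leq_maxr m n)).
  by apply: mP; apply: (na_le VP (leq_maxl m n)).
have /choice[f fP] x : exists t, Phi t = s x by apply: KPhi; exists x.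
have [||F FE] := @mkchom A (free_sum a b) f.
- apply: (lift_continuous VP Phi_open) => x; rewrite (_ : (fun y => Phi (f y)) = s).
    exact: chom_continuous.
  exact/funext.
- by move=> x y; apply: PhiI; rewrite (chom_zmod_morphism Phi) !fP (chom_zmod_morphism s).
exists a, b, F, (postcomp q Phi); split.
- by move=> x; rewrite /= FE fP qs.
- move=> t; rewrite FE; apply: PhiI; rewrite fP /=.
  by have [x _ <-] := PhiK t; rewrite qs.
Qed.

(** Each coordinate of [c] is a cocycle with values in [Zdisc] or [Zomega]. The coordinatewise
    solutions assemble freely, since continuity into a product is tested on coordinates. *)
Lemma Ext_eq0_free_sum (R : realType) (A : topologicalZmodType) (a b : option nat)
    (c : cocycle A (free_sum a b)) : PAb_nA R A ->
  Ext_eq0 R A Zdisc -> Ext_eq0 R A Zomega ->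
  exists2 psi : A -> free_sum a b, continuous psi &
    forall x y, psi x + psi y = psi (x + y) + c x y.
Proof.
move=> [Ap _] ext1 ext2.
have [Z1 _] := Zdisc_PAb_nA R; have [Z2 _] := Zomega_PAb_nA R.
have /choice[psi1 psi1P] i : exists psi : A -> Zdisc, continuous psi /\
    forall x y, psi x + psi y = psi (x + y) + (c x y).1 i.
  have [c' c'E] := cocycle_comp c (postcomp (chom_eval Zdisc i) (chom_fst _ _)).
  have [psi psiC psiE] := Ext_eq0_coboundary c' Ap Z1 ext1.
  by exists psi; split=> // x y; rewrite psiE c'E.
have /choice[psi2 psi2P] i : exists psi : A -> Zomega, continuous psi /\
    forall x y, psi x + psi y = psi (x + y) + (c x y).2 i.
  have [c' c'E] := cocycle_comp c (postcomp (chom_eval Zomega i) (chom_snd _ _)).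
  have [psi psiC psiE] := Ext_eq0_coboundary c' Ap Z2 ext2.
  by exists psi; split=> // x y; rewrite psiE c'E.
have psi1C : continuous (fun x => (fun i => psi1 i x) : power (index_set a) Zdisc).
  by apply: power_continuous => i; case: (psi1P i).
have psi2C : continuous (fun x => (fun i => psi2 i x) : power (index_set b) Zomega).
  by apply: power_continuous => i; case: (psi2P i).
exists (fun x => ((fun i => psi1 i x), (fun i => psi2 i x))).
  exact: continuous_pair.
move=> x y; congr pair; apply/funext => i.
  exact: (psi1P i).2.
exact: (psi2P i).2.
Qed.

Lemma Ext_eq0_split_resolution (R : realType) (A : topologicalZmodType) :
  PAb_nA R A -> Ext_eq0 R A Zdisc -> Ext_eq0 R A Zomega ->
  exists (s : chom A Pomega) (q : chom Pomega A), forall x, q (s x) = x.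
Proof.
move=> AP ext1 ext2; have [U UP] := PAb_nA_na_basis AP; have VP := Pbasis_na_basis.
have [d dP] := polish_dense (0 : A) AP.1.
have [q [sg [sgC sg0 qsg]]] := resolution UP (fun x n => dP x _ (na_coset UP n x)).
have qN n : exists m, forall x, Pbasis m x -> U n (q x).
  have h : nbhs 0 (q @^-1` U n).
    have := @chom_continuous _ _ q 0 (U n); rewrite raddf0; apply.
    exact: na_nbhs UP n.
  by have [m mP] := na_small VP h; exists m => x /mP.
have [||a [b [Phi [PhiK KPhi PhiI Phi_open]]]] :=
    @closed_subgroup_Pomega [set x | q x = 0].
- split; first exact: raddf0.
  by move=> x y /= qx qy; rewrite (chom_zmod_morphism q) qx qy subrr.
- move=> x xP; apply: (na_sep UP) => n; have [m mP] := qN n.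
  have [y /= qy /mP] := xP m.
  by rewrite (chom_zmod_morphism q) qy subr0.
have PhiD x y : Phi (x + y) = Phi x + Phi y by exact: raddfD.
(* The failure of [sg] to be additive lies in the kernel of [q], hence in the image of [Phi];
   injectivity of [Phi] transfers the cocycle identities to [c]. *)
have /choice[c cP] (x : A * A) : exists t, Phi t = sg x.1 + sg x.2 - sg (x.1 + x.2).
  by apply: KPhi; rewrite /= (chom_zmod_morphism q) raddfD /= !qsg subrr.
have cC : continuous (fun x : A * A => c (x.1, x.2)).
  apply: (lift_continuous VP Phi_open).
  have -> : (fun x => Phi (c (x.1, x.2))) = fun x => sg x.1 + sg x.2 - sg (x.1 + x.2).
    by apply/funext => x; rewrite cP.
  apply: (continuousB (f := fun x => sg x.1 + sg x.2)).
    apply: continuousD => x.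
      by apply: (@continuous_comp _ _ _ fst sg); [exact: cvg_fst|exact: sgC].
    by apply: (@continuous_comp _ _ _ snd sg); [exact: cvg_snd|exact: sgC].
  move=> x; apply: (@continuous_comp _ _ _ (fun x : A * A => x.1 + x.2) sg).
    exact: add_continuous.
  exact: sgC.
have cS x y : c (x, y) = c (y, x).
  by apply: PhiI; rewrite !cP /= (addrC y) (addrC (sg y)).
have cA x y z : c (x, y) + c (x + y, z) = c (y, z) + c (x, y + z).
  have e : x + (y + z) = x + y + z by rewrite addrA.
  by apply: PhiI; rewrite !PhiD !cP /= e; zmod.
have c0 x : c (0, x) = 0.
  by apply: PhiI; rewrite cP /= add0r sg0 add0r subrr raddf0.
have [psi psiC psiE] := Ext_eq0_free_sum
  (@Cocycle A (free_sum a b) (fun x y => c (x, y)) cC cS cA c0) AP ext1 ext2.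
have PhiPsiC : continuous (fun x => Phi (psi x)).
  by move=> x; apply: (@continuous_comp _ _ _ psi Phi); [exact: psiC|exact: chom_continuous].
(* The coboundary identity for [psi] cancels exactly this failure. *)
have sD x y : sg (x + y) - Phi (psi (x + y)) = sg x - Phi (psi x) + (sg y - Phi (psi y)).
  have := congr1 Phi (psiE x y); rewrite !PhiD /= cP /= => e.
  have -> : sg x - Phi (psi x) + (sg y - Phi (psi y)) =
    sg x + sg y - (Phi (psi x) + Phi (psi y)) by zmod.
  by rewrite e; zmod.
have [||s sE] := @mkchom A Pomega (fun x => sg x - Phi (psi x)).
- exact: continuousB.
- by move=> x y; have := sD (x - y) y; rewrite subrK => ->; zmod.
exists s, q => x; rewrite sE (chom_zmod_morphism q) qsg.
by have /= -> := PhiK (psi x); rewrite subr0.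
Qed.

Theorem theorem4p14 (R : realType) (A : topologicalZmodType) (hA : PAb_nA R A) :
  (projective R A <->
   exists alpha beta : option nat,
     top_isomorphic A
       (direct_sum (power (index_set alpha) Zdisc)
                   (power (index_set beta) Zomega))) /\
  ((exists alpha beta : option nat,
     top_isomorphic A
       (direct_sum (power (index_set alpha) Zdisc)
                   (power (index_set beta) Zomega))) <->
   Ext_eq0 R A Zdisc /\ Ext_eq0 R A Zomega).
Proof.
have iso_proj : (exists a b, top_isomorphic A (free_sum a b)) -> projective R A.
  move=> [a [b [f [g [fK _]]]]]; have [s [r rs]] := free_sum_retract a b.
  apply: (@retract_projective R A (postcomp s f) (postcomp g r)) => x.
  by rewrite /= rs fK.
have proj_ext : projective R A -> Ext_eq0 R A Zdisc /\ Ext_eq0 R A Zomega.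
  move=> Aproj; split; apply: projective_Ext_eq0 => //.
    exact: Zdisc_PAb_nA.
  exact: Zomega_PAb_nA.
have ext_iso : Ext_eq0 R A Zdisc /\ Ext_eq0 R A Zomega ->
    exists a b, top_isomorphic A (free_sum a b).
  move=> [ext1 ext2]; have [s [q qs]] := Ext_eq0_split_resolution hA ext1 ext2.
  exact: split_Pomega_free_sum qs.
split; split.
- by move=> /proj_ext/ext_iso.
- exact: iso_proj.
- by move=> /iso_proj/proj_ext.
- exact: ext_iso.
Qed.
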